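(* Let $X=(X_1,X_2,\ldots,X_n)$ be a standard Gaussian vector with $\mathrm{Cov}(X_i,X_j)\in[0,1)$ for all $i<j$. If $X$ is not fully supported, then for all sufficiently large $h$, $X^h$ is not a color process.
   Context: A $\{0,1\}$-valued process $(Y_i)_{i\in S}$ is a color process (divide and color process) if there are $p\in[0,1]$ and a random partition $\pi$ of $S$ such that $(Y_i)$ has the same law as the process obtained by sampling $\pi$ and then, independently of $\pi$ and independently for different partition elements, assigning all elements of a partition element the value $1$ with probability $p$ and the value $0$ with probability $1-p$. For a random vector $X=(X_i)$ and $h\in\mathbb{R}$, $X^h=(X^h_i)$ with $X^h_i=I(X_i>h)$. A Gaussian vector is standard if each marginal has mean zero and variance one; it is fully supported if the support of its law is all of $\mathbb{R}^n$ (equivalently, its covariance matrix is invertible). *)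

(* Defs.v *)
From HB Require Import structures.
From mathcomp Require Import all_boot all_order all_algebra.
From mathcomp Require Import all_classical all_reals all_analysis.
Import Order.TTheory GRing.Theory Num.Theory.
Import numFieldNormedType.Exports.

Set Implicit Arguments.
Unset Strict Implicit.
Unset Printing Implicit Defensive.

Local Open Scope classical_set_scope.
Local Open Scope ring_scope.

(* Point masses count as Gaussian.  They need their own case because
   [normal_prob m 0] is not [\d_m] (it is the uniform law on [0, 1]). *)
Definition gaussian_law (R : realType) (mu : set R -> \bar R) : Prop :=
  exists m s : R, 0 <= s /\
    forall A : set R, measurable A ->
      mu A = if s == 0 then \d_m A else normal_prob m s A.

Definition gaussian_vector (R : realType) (d : measure_display)
    (T : measurableType d) (P : probability T R) (n : nat)
    (X : 'I_n -> {RV P >-> R}) : Prop :=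
  forall a : 'I_n -> R,
    gaussian_law (pushforward P (fun w : T => \sum_(i < n) a i * X i w)).

Definition standard_gaussian_vector (R : realType) (d : measure_display)
    (T : measurableType d) (P : probability T R) (n : nat)
    (X : 'I_n -> {RV P >-> R}) : Prop :=
  gaussian_vector X /\
  forall i : 'I_n, ('E_P[X i] = 0)%E /\ ('V_P[X i] = 1)%E.

Definition law_support (R : realType) (n : nat)
    (mu : set 'rV[R]_n -> \bar R) : set 'rV[R]_n :=
  [set x | forall U : set 'rV[R]_n, open U -> U x -> (0 < mu U)%E].

Definition fully_supported (R : realType) (d : measure_display)
    (T : measurableType d) (P : probability T R) (n : nat)
    (X : 'I_n -> {RV P >-> R}) : Prop :=
  law_support (fun A => P ((fun w : T => \row_(i < n) X i w) @^-1` A)) = setT.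

Definition threshold (R : realType) (d : measure_display)
    (T : measurableType d) (P : probability T R) (n : nat)
    (X : 'I_n -> {RV P >-> R}) (h : R) (i : 'I_n) (w : T) : bool :=
  h < X i w.

(* The law of a random partition of the finite set [S], given by its
   probability mass function. *)
Definition partition_law (R : realType) (S : finType)
    (q : {set {set S}} -> R) : Prop :=
  [/\ forall rho, 0 <= q rho,
      forall rho, ~~ finset.partition rho [set: S]%SET -> q rho = 0
    & \sum_rho q rho = 1].

(* An independent p-coin is attached to every subset of [S]; sampling [rho] and
   the coins independently, the site [i] receives the coin of its block
   [pblock rho i].  Coins of subsets that are not blocks of [rho] are unused, and
   distinct blocks get distinct, hence independent, coins. *)
Definition color_process_law (R : realType) (S : finType) (p : R)
    (q : {set {set S}} -> R) (y : {ffun S -> bool}) : R :=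
  \sum_(rho : {set {set S}})
    \sum_(c : {ffun {set S} -> bool} |
          y == [ffun i => c (finset.pblock rho i)])
      q rho * \prod_(B : {set S}) bernoulli_pmf p (c B).

Definition color_process (R : realType) (d : measure_display)
    (T : measurableType d) (P : probability T R) (S : finType)
    (Y : S -> T -> bool) : Prop :=
  exists (p : R) (q : {set {set S}} -> R),
    [/\ 0 <= p <= 1, partition_law q
      & forall y : {ffun S -> bool},
          P [set w | forall i, Y i w = y i] = (color_process_law p q y)%:E].

(* Main.v *)
(* If X is not fully supported, some nontrivial linear combination sum a_i X_i
   vanishes almost surely, and we may assume sum a_i >= 0.  For h >= 0 the pattern
   "X_i > h where a_i > 0, X_i <= h where a_i < 0" then has probability zero.  If X^h
   were a color process with 0 < p < 1, almost every partition would put some i with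
   a_i > 0 and some j with a_j < 0 in a common block, so
     p <= sum_(i, j) p P(i ~ j) <= sum_(i, j) P(X_i > h, X_j > h).
   But {X_i > h, X_j > h} forces (X_i + X_j) / 2 > h, and this variable is normal with
   variance < 1, so each term is o(P(X_i > h)) = o(p) as h tends to infinity.

   For the existence of a: if the covariance matrix is positive definite, write X as
   an invertible linear image of Z with E cos (a.Z + b) = cos b exp (- |a|^2 / 2).
   Averaging over frequencies computes E prod_i exp (- t^2 (Z_i - z_i)^2 / 2), which
   decays only polynomially in t; hence Z charges every neighbourhood of every z. *)

Require Import Defs.
From HB Require Import structures.
From mathcomp Require Import all_boot all_order all_algebra.
From mathcomp Require Import all_classical all_reals all_analysis.
From mathcomp Require Import measurable_realfun ring lra.
Import Order.TTheory GRing.Theory Num.Theory.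
Import numFieldNormedType.Exports.

Local Open Scope classical_set_scope.
Local Open Scope ring_scope.

Set Implicit Arguments.
Unset Strict Implicit.
Unset Printing Implicit Defensive.

(** * Integrals against the standard normal density *)

Section gauss.
Variable R : realType.
Implicit Types (s t x z b m : R) (f g F : R -> R).
Notation mu := (@lebesgue_measure R).

Definition phi : R -> R := normal_pdf 0 1.

Lemma phiE z : phi z = normal_peak 1 * expR (- (z ^+ 2 / 2)).
Proof.
rewrite /phi /normal_pdf oner_eq0 /normal_fun subr0 expr1n.
by rewrite mulNr.
Qed.

Lemma phi_ge0 z : 0 <= phi z. Proof. exact: normal_pdf_ge0. Qed.

Lemma continuous_phi : continuous phi.
Proof. by apply: continuous_normal_pdf; rewrite oner_eq0. Qed.

Lemma measurable_phi : measurable_fun [set: R] phi.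
Proof. exact: measurable_normal_pdf. Qed.

Lemma is_derive_phi z : is_derive z 1 phi (- (z * phi z)).
Proof.
have -> : phi = (fun z => normal_peak 1 * expR (- (z ^+ 2 / 2))).
  by apply/funext => y; rewrite phiE.
by apply: is_derive_eq; rewrite /GRing.scale/=; field.
Qed.

(** Half of the exponent absorbs the quadratic factor, by [expR y >= 1 + y] at [y = z ^+ 2 / 4];
    what is left decays like a normal density of variance 2. *)
Lemma phi_le z : (1 + z ^+ 2) * phi z <= 4 * normal_peak 1 * expR (- (z ^+ 2 / 4)).
Proof.
have e1 : 1 + z ^+ 2 / 4 <= expR (z ^+ 2 / 4) by exact: expR_ge1Dx.
have -> : expR (- (z ^+ 2 / 4)) = expR (z ^+ 2 / 4) * expR (- (z ^+ 2 / 2)).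
  by rewrite -expRD; congr expR; field.
rewrite phiE [leLHS](_ : _ = normal_peak 1 * expR (- (z ^+ 2 / 2)) * (1 + z ^+ 2)); last ring.
rewrite [leRHS](_ : _ = normal_peak 1 * expR (- (z ^+ 2 / 2)) * (4 * expR (z ^+ 2 / 4))); last ring.
rewrite ler_wpM2l ?mulr_ge0 ?normal_peak_ge0 ?expR_ge0//.
by have := sqr_ge0 z; lra.
Qed.

Lemma integrable_sqr_phi : mu.-integrable [set: R]
  (fun z => ((1 + z ^+ 2) * phi z)%:E).
Proof.
have s2 : Num.sqrt 2 != 0 :> R by rewrite sqrtr_eq0 -ltNge.
(* The density with deviation [Num.sqrt 2] has exponent [- (z ^+ 2 / 4)], so [C] times it is exactly
   the right-hand side of [phi_le]. *)
pose C : R := 4 * normal_peak 1 / normal_peak (Num.sqrt 2).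
have := integrableZl measurableT C (integrable_normal_pdf 0 (Num.sqrt 2)).
apply: le_integrable => //.
  apply/measurable_EFinP; apply: measurable_funM; last exact: measurable_phi.
  by apply: measurable_funD => //; exact: measurable_funX.
move=> z _; rewrite -EFinM !abse_EFin lee_fin ger0_norm; last first.
  by rewrite mulr_ge0 ?phi_ge0// addr_ge0// sqr_ge0.
rewrite ger0_norm; last first.
  by rewrite !mulr_ge0 ?normal_peak_ge0 ?invr_ge0 ?normal_peak_ge0 ?normal_pdf_ge0.
apply: (le_trans (phi_le z)).
rewrite /normal_pdf (negbTE s2) /normal_fun subr0 sqr_sqrtr//.
rewrite /C mulrA divfK ?gt_eqF ?normal_peak_gt0//.
by rewrite ler_wpM2l ?mulr_ge0 ?normal_peak_ge0// ler_expR; lra.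
Qed.

Lemma integrable_phiM A f : measurable_fun [set: R] f ->
  (forall z, `|f z| <= A * (1 + z ^+ 2)) ->
  mu.-integrable [set: R] (EFin \o (fun z => f z * phi z)).
Proof.
move=> mf fA.
have := integrableZl measurableT A integrable_sqr_phi.
apply: le_integrable => //.
  by apply/measurable_EFinP; apply: measurable_funM => //; exact: measurable_phi.
move=> z _; rewrite -EFinM /comp !abse_EFin lee_fin /= normrM (ger0_norm (phi_ge0 z)) mulrA.
by rewrite normrM (ger0_norm (phi_ge0 z)) ler_wpM2r ?phi_ge0// (le_trans (fA z))// ler_norm.
Qed.

(** Dominated convergence with dominating function [|f|]: at a fixed point the truncations
    eventually equal [f]. *)
Lemma cvg_symmetric_integral f : mu.-integrable [set: R] (EFin \o f) ->
  \int[mu]_(x in `[- n.+1%:R, n.+1%:R]) f x @[n --> \oo] --> \int[mu]_x f x.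
Proof.
move=> intf; apply: fine_cvg; rewrite fineK; last exact: integrable_fin_num.
under eq_fun do rewrite integral_mkcond.
apply: (@dominated_cvg _ _ _ mu _ measurableT _ _ (fun x => `|(f x)%:E|)%E).
- move=> n;  have mf := measurable_int mu intf.
  by apply: (measurable_restrictT _ _).1 => //; apply: measurable_funTS.
- move=> x _; apply: cvg_near_cst.
  near=> n; rewrite patchE ifT// inE/= in_itv/= -ler_norml.
  near: n; exists (Num.trunc `|x|) => // n /= xn.
  apply: ltW; apply: (lt_le_trans (Num.Theory.truncnS_gt _)).
  by rewrite ler_nat ltnS.
- by [].
- exact: integrable_abse.
- by move=> n x _; rewrite patchE; case: ifP => //; rewrite abse0.
Unshelve. all: by end_near. Qed.

Lemma integral_derive_eq0 F f :
  (forall x : R, is_derive x 1 F (f x)) -> continuous f ->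
  mu.-integrable [set: R] (EFin \o f) ->
  F n.+1%:R @[n --> \oo] --> (0:R) -> F (- n.+1%:R) @[n --> \oo] --> (0:R) ->
  \int[mu]_x f x = 0.
Proof.
move=> dF cf intf Fy FNy.
have /cvg_unique := cvg_symmetric_integral intf; apply => //.
have -> : (fun n => \int[mu]_(x in `[- n.+1%:R, n.+1%:R]) f x) =
    (fun n => F n.+1%:R - F (- n.+1%:R)).
  apply/funext => n; rewrite /Rintegral (@continuous_FTC2 _ _ F)//.
  - by rewrite -subr_gt0 opprK -natrD ltr0n.
  - exact: continuous_subspaceT.
  - have cF x : {for x, continuous F}.
      by apply/differentiable_continuous/derivable1_diffP; exact: ex_derive.
    split=> [x _||]; first exact: ex_derive.
    + exact/cvg_at_right_filter/cF.
    + exact/cvg_at_left_filter/cF.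
  - by move=> x _; rewrite derive1E derive_val.
have := cvgB Fy FNy; rewrite subr0; exact.
Qed.

(** Gaussian integration by parts: since [phi' = - z phi], the difference of the two integrands is
    the derivative of [g * phi], which vanishes at both infinities. *)
Lemma stein A g g' : (forall x : R, is_derive x 1 g (g' x)) -> continuous g' ->
  (forall z, `|g z| <= A * (1 + `|z|)) -> (forall z, `|g' z| <= A) ->
  \int[mu]_z (z * g z * phi z) = \int[mu]_z (g' z * phi z).
Proof.
move=> dg cg' gA g'A.
have A0 : 0 <= A by apply: le_trans (g'A 0).
have cg : continuous g.
  by move=> x; apply/differentiable_continuous/derivable1_diffP; exact: ex_derive.
have zg z : `|z * g z| <= A *+ 2 * (1 + z ^+ 2).
  rewrite normrM; apply: (@le_trans _ _ (`|z| * (A * (1 + `|z|)))).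
    by rewrite ler_wpM2l.
  have := real_normK (num_real z); have := normr_ge0 z.
  move: `|z| => w w0 <-; have := mulr_ge0 A0 (sqr_ge0 (w - 1)); have := mulr_ge0 A0 w0.
  by rewrite mulr2n; lra.
have i1 : mu.-integrable [set: R] (EFin \o (fun z => z * g z * phi z)).
  apply: integrable_phiM zg.
  by apply: measurable_funM => //; exact: continuous_measurable_fun.
have i2 : mu.-integrable [set: R] (EFin \o (fun z => g' z * phi z)).
  apply: (@integrable_phiM A); first exact: continuous_measurable_fun.
  by move=> z; rewrite (le_trans (g'A z))// ler_peMr// lerDl sqr_ge0.
(* The 8 is 2 from [zg] times 4 from [phi_le]. Boundedness of [z * g z * phi z] makes [g * phi]
   decay at least like the inverse of [|z|], enough along the integers. *)
have K z : `|g z * phi z| * `|z| <= A *+ 8 * normal_peak 1.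
  rewrite normrM (ger0_norm (phi_ge0 z)) mulrC mulrA -normrM.
  apply: (@le_trans _ _ (A *+ 2 * ((1 + z ^+ 2) * phi z))).
    by rewrite mulrA ler_wpM2r ?phi_ge0.
  rewrite [leRHS](_ : _ = A *+ 2 * (4 * normal_peak 1)); last by ring.
  rewrite ler_wpM2l ?mulrn_wge0// (le_trans (phi_le z))//.
  rewrite ler_piMr ?mulr_ge0 ?normal_peak_ge0// expR_le1.
  by have := sqr_ge0 z; lra.
have lim0 (u : nat -> R) : (forall n, `|u n| = n.+1%:R) ->
    g (u n) * phi (u n) @[n --> \oo] --> (0:R).
  move=> un; apply: norm_cvg0.
  have h0 : A *+ 8 * normal_peak 1 * harmonic n @[n --> \oo] --> (0 : R).
    by have := cvgM (cvg_cst (A *+ 8 * normal_peak 1)) (@cvg_harmonic R); rewrite mulr0; exact.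
  apply: squeeze_cvgr (cvg_cst 0) h0.
  apply: nearW => n; rewrite normr_ge0/= /harmonic ler_pdivlMr ?ltr0n//.
  by rewrite -un K.
apply/esym/subr0_eq; rewrite -RintegralB//.
apply: (@integral_derive_eq0 (fun z => g z * phi z)).
- move=> x; have := is_derive_phi x; have := dg x => ? ?.
  by apply: is_derive_eq; rewrite /GRing.scale/=; ring.
- move=> x; apply: cvgB; apply: cvgM; try exact: continuous_phi; try exact: cg'.
  by apply: cvgM; [exact: cvg_id|exact: cg].
- exact: (integrableB measurableT i2 i1).
- by apply: lim0 => n; rewrite ger0_norm.
- by apply: lim0 => n; rewrite normrN ger0_norm.
Qed.
End gauss.

(** * Moments and cosine transform of the standard normal density *)

Section gauss_moments.
Variable R : realType.
Implicit Types (s t x z b m : R) (f g F : R -> R).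
Notation mu := (@lebesgue_measure R).

Lemma integral_phi : \int[mu]_z phi z = 1.
Proof. by rewrite /Rintegral integral_normal_pdf. Qed.

Lemma integral_id_phi : \int[mu]_z (z * phi z) = 0.
Proof.
have := @stein R 1 (cst 1) (cst 0) (fun=> is_derive_cst _ _ _) (fun=> cvg_cst _).
rewrite /cst => H; under eq_Rintegral do rewrite -[X in X * _](mulr1 _).
rewrite H.
- by under eq_Rintegral do rewrite mul0r; rewrite Rintegral_cst// mul0r.
- by move=> z; rewrite normr1 mul1r lerDl.
- by move=> z; rewrite normr0.
Qed.

Lemma integral_sqr_phi : \int[mu]_z (z ^+ 2 * phi z) = 1.
Proof.
have := @stein R 1 id (cst 1) (fun x => is_derive_id x 1) (fun=> cvg_cst _).
rewrite /cst => H; under eq_Rintegral do rewrite expr2.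
rewrite H.
- by under eq_Rintegral do rewrite mul1r; exact: integral_phi.
- by move=> z; rewrite mul1r lerDr.
- by move=> z; rewrite normr1.
Qed.

Lemma norm_cos_le1 x : `|cos x| <= 1.
Proof. by rewrite ler_norml cos_geN1 cos_le1. Qed.

Lemma norm_sin_le1 x : `|sin x| <= 1.
Proof. by rewrite ler_norml sin_geN1 sin_le1. Qed.

Let continuous_cosM s b : continuous (fun z => cos (s * z + b)).
Proof.
move=> x; apply/differentiable_continuous/derivable1_diffP.
exact: ex_derive.
Qed.

Let continuous_sinM s b : continuous (fun z => sin (s * z + b)).
Proof.
move=> x; apply/differentiable_continuous/derivable1_diffP.
exact: ex_derive.
Qed.

Lemma integrable_cos_phi s b :
  mu.-integrable [set: R] (EFin \o (fun z => cos (s * z + b) * phi z)).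
Proof.
apply: (@integrable_phiM _ 1); first exact: continuous_measurable_fun.
by move=> z; rewrite (le_trans (norm_cos_le1 _))// mul1r lerDl sqr_ge0.
Qed.

(* As a function of [s] the integral [F] satisfies F' = - s F, by differentiation
   under the integral sign followed by [stein]. *)
Lemma integral_cos_phi s b :
  \int[mu]_z (cos (s * z + b) * phi z) = cos b * expR (- (s ^+ 2 / 2)).
Proof.
pose f s z := cos (s * z + b) * phi z.
pose F s := \int[mu]_z f s z.
have df s' z : is_derive s' 1 (f ^~ z) (- (z * sin (s' * z + b) * phi z)).
  by apply: is_derive_eq; rewrite /GRing.scale/=; ring.
have d1f s' : partial1of2 f s' = (fun z => - (z * sin (s' * z + b) * phi z)).
  by apply/funext => z; rewrite partial1of2E derive_val.
have dF s' : is_derive s' 1 F (- (s' * F s')).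
  have int1 x : mu.-integrable [set: R] (EFin \o f x) by exact: integrable_cos_phi.
  have bnd x y : `|partial1of2 f x y| <= (1 + y ^+ 2) * phi y.
    rewrite d1f normrN !normrM (ger0_norm (phi_ge0 y)) ler_wpM2r ?phi_ge0//.
    apply: (@le_trans _ _ `|y|); first by rewrite ler_piMr// norm_sin_le1.
    have := real_normK (num_real y); move: `|y| => w <-.
    by have := sqr_ge0 (w - 1); have := sqr_ge0 (w + 1); lra.
  have Is : `]s' - 1, s' + 1[%classic s' by rewrite /= in_itv/=; apply/andP; split; lra.
  have G0 (y : R) : 0 <= (1 + y ^+ 2) * phi y.
    by rewrite mulr_ge0 ?phi_ge0// addr_ge0// sqr_ge0.
  have dfF := @derivable_under_integral _ _ _ mu f setT measurableT s' _ _ Is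
    (fun x _ => int1 x) (fun x y _ _ => @ex_derive _ _ _ _ _ _ _ (df x y))
    _ G0 (integrable_sqr_phi R) (fun x y _ _ => bnd x y).
  have dvF := @differentiation_under_integral _ _ _ mu f setT measurableT s' _ _ Is
    (fun x _ => int1 x) (fun x y _ _ => @ex_derive _ _ _ _ _ _ _ (df x y))
    _ G0 (integrable_sqr_phi R) (fun x y _ _ => bnd x y).
  split=> //; rewrite -derive1E dvF d1f.
  (* [stein] with [g z = - sin (s' * z + b)] removes the factor [z] and turns the sine into [- s']
     times the cosine of [F]. *)
  have dS (x : R) : is_derive x 1 (fun z => - sin (s' * z + b)) (- (s' * cos (s' * x + b))).
    by apply: is_derive_eq; rewrite /GRing.scale/=; ring.
  have H := @stein R (1 + `|s'|) _ (fun z => - (s' * cos (s' * z + b))) dS.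
  under eq_Rintegral do rewrite -mulNr -mulrN.
  rewrite H.
  - rewrite -mulNr /F /f -RintegralZl//; last exact: integrable_cos_phi.
    by apply: eq_Rintegral => z _; ring.
  - by move=> x; apply: cvgN; apply: cvgM; [exact: cvg_cst|exact: continuous_cosM].
  - move=> z; rewrite normrN (le_trans (norm_sin_le1 _))//.
    by have := normr_ge0 z; have := normr_ge0 s'; nra.
  - move=> z; rewrite normrN normrM (@le_trans _ _ `|s'|)//; last by rewrite lerDr.
    by rewrite ler_piMr// norm_cos_le1.
(* Integrating factor for F' = - s F; the resulting constant is the value at 0, namely [cos b]. *)
have dcst x : is_derive x 1 (fun s => F s * expR (s ^+ 2 / 2)) 0.
  by have := dF x => ?; apply: is_derive_eq; rewrite /GRing.scale/=; field.
have := is_derive_0_is_cst s 0 dcst.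
rewrite expr0n/= mul0r expR0 mulr1 {2}/F /f.
under eq_Rintegral do rewrite mul0r add0r.
rewrite RintegralZl//; last exact: integrable_normal_pdf.
rewrite integral_phi mulr1 => <-.
by rewrite -mulrA -expRD subrr expR0 mulr1.
Qed.
End gauss_moments.

(** * Integration of nonnegative functions against a Gaussian law *)

Section gauss_law.
Variable R : realType.
Implicit Types (s t x z b m : R) (f g F : R -> R).
Notation mu := (@lebesgue_measure R).

(** The Radon-Nikodym derivative of [normal_prob m s] agrees almost everywhere with
    [normal_pdf m s], because both have the same integral over every measurable set. *)
Lemma ge0_integral_normal_prob m s f : measurable_fun [set: R] f ->
  (forall x, 0 <= f x) ->
  (\int[normal_prob m s]_x (f x)%:E = \int[mu]_x (f x * normal_pdf m s x)%:E)%E.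
Proof.
move=> mf f0.
have dom := normal_prob_dominates m s.
have mf' : measurable_fun [set: R] (fun x => (f x)%:E) by exact/measurable_EFinP.
rewrite -(Radon_Nikodym_SigmaFinite.change_of_variables dom)//=.
under [RHS]eq_integral do rewrite EFinM.
have mp : measurable_fun [set: R] (fun x => (normal_pdf m s x)%:E).
  by apply/measurable_EFinP; exact: measurable_normal_pdf.
have intd := Radon_Nikodym_SigmaFinite.f_integrable dom.
apply: ae_eq_integral => //.
- apply: emeasurable_funM => //.
  exact: measurable_int intd.
- exact: emeasurable_funM.
- apply: ae_eqe_mul2l; apply: integral_ae_eq => // E _ mE.
  by rewrite -Radon_Nikodym_SigmaFinite.f_integral.
Qed.

Lemma normal_pdf_affine m s z : 0 < s -> normal_pdf m s (m + s * z) * s = phi z.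
Proof.
move=> s0; rewrite phiE /normal_pdf gt_eqF// /normal_fun /normal_peak.
have -> : m + s * z - m = s * z by ring.
rewrite expr1n mul1r -mulrnAr sqrtrM ?sqr_ge0// sqrtr_sqr gtr0_norm//.
have -> : - (s * z) ^+ 2 / (s ^+ 2 *+ 2) = - (z ^+ 2 / 2) by field; rewrite gt_eqF.
have : Num.sqrt (pi *+ 2) != 0 :> R by rewrite sqrtr_eq0 -ltNge mulrn_wgt0 ?pi_gt0.
by move=> pi2; field; rewrite pi2 gt_eqF.
Qed.

Lemma integral_normal_prob_affine m s f : 0 < s -> continuous f ->
  (forall x, 0 <= f x) ->
  (\int[normal_prob m s]_x (f x)%:E = \int[mu]_z (f (m + s * z) * phi z)%:E)%E.
Proof.
move=> s0 cf f0.
rewrite ge0_integral_normal_prob//; last exact: continuous_measurable_fun.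
pose F z : R := m + z * s.
have dF z : is_derive z 1 F s.
  by apply: is_derive_eq; rewrite /GRing.scale/=; ring.
have F'E : F^`()%classic = cst s.
  by apply/funext => x; rewrite derive1E derive_val.
rewrite (@increasing_ge0_integration_by_substitutionT _ F).
- apply: eq_integral => z _; rewrite F'E; congr _%:E.
  rewrite !fctE /= /F.
  by rewrite -mulrA (mulrC z) normal_pdf_affine.
- by move=> x y xy; rewrite /F ltrD2l ltr_pM2r.
- by rewrite F'E => ?; exact: cvg_cst.
- by rewrite F'E; exact: is_cvg_cst.
- by rewrite F'E; exact: is_cvg_cst.
- by move=> x; exact: ex_derive.
- exact: cvg_comp (gt0_cvgMlNy s0 cvg_id) (cvg_addrl_Ny m).
- exact: cvg_comp (gt0_cvgMly s0 cvg_id) (cvg_addrl m).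
- move=> x; apply: cvgM; first exact: cf.
  by apply: continuous_normal_pdf; rewrite gt_eqF.
- by move=> x; rewrite mulr_ge0// normal_pdf_ge0.
Qed.

(** One formula serves both cases of [gaussian_law]: for [s = 0] the right integrand is the constant
    [f m] times a density of mass one. Signed functions of [Y] are reached later from nonnegative
    ones. *)
Lemma gaussian_law_integral d (T : measurableType d) (P : probability T R)
    (Y : T -> R) : measurable_fun [set: T] Y ->
  gaussian_law (pushforward P Y) ->
  exists m s : R, [/\ 0 <= s,
    forall A : set R, measurable A ->
      P (Y @^-1` A) = if s == 0 then \d_m A else normal_prob m s A
    & forall f, continuous f -> (forall x, 0 <= f x) ->
      (\int[P]_w (f (Y w))%:E = \int[mu]_z (f (m + s * z) * phi z)%:E)%E].
Proof.
move=> mY [m [s [s0 lawY]]]; exists m, s; split => // f cf f0.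
have {}lawY A : measurable A ->
    P (Y @^-1` A) = if s == 0 then \d_m A else normal_prob m s A by exact: lawY.
have mf : measurable_fun [set: R] (fun x => (f x)%:E).
  by apply/measurable_EFinP; exact: continuous_measurable_fun.
(* [normal_prob] is a measure on [measurableTypeR R], whose display is not that of [R]. *)
have mY' : @measurable_fun _ _ T (measurableTypeR R) setT Y by exact: mY.
pose Y' : {mfun T >-> measurableTypeR R} := HB.pack Y (isMeasurableFun.Build _ _ T (measurableTypeR R) Y mY').
rewrite -(@ge0_integral_distribution _ _ _ _ _ P Y' (fun x => (f x)%:E))//.
have [sE|sN0] := eqVneq s 0.
  rewrite sE; under [RHS]eq_integral do rewrite mul0r addr0 EFinM.
  rewrite integralZl//; last exact: integrable_normal_pdf.
  rewrite integral_normal_pdf mule1.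
  rewrite (_ : (f m)%:E = \int[@dirac _ (measurableTypeR R) m R]_x (f x)%:E)%E; last first.
    by rewrite integral_dirac// diracT mul1e.
  by apply: eq_measure_integral => A mA _; have := lawY A mA; rewrite sE eqxx; apply.
rewrite -integral_normal_prob_affine//; last by rewrite lt_neqAle eq_sym sN0.
apply: (eq_measure_integral (normal_prob m s)) => A mA _; have := lawY A mA; rewrite (negbTE sN0); apply.
Qed.

End gauss_law.

(** * Linear combinations of a Gaussian vector *)

Section gauss_vector.
Variables (R : realType) (d : measure_display) (T : measurableType d).
Variable P : probability T R.
Implicit Types (s t x z b m c : R) (f g F : R -> R) (Y : T -> R).
Notation mu := (@lebesgue_measure R).

Lemma integrable_bounded A (f : T -> R) : measurable_fun [set: T] f ->
  (forall w, `|f w| <= A) -> P.-integrable [set: T] (EFin \o f).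
Proof.
move=> mf fA.
have := finite_measure_integrable_cst P A measurableT.
apply: le_integrable => //; first exact/measurable_EFinP.
by move=> w _ /=; rewrite lee_fin (le_trans (fA w))// ler_norm.
Qed.

Lemma Rintegral_sum (I : Type) (r : seq I) (f : I -> T -> R) :
  (forall i, P.-integrable [set: T] (EFin \o f i)) ->
  \int[P]_w (\sum_(i <- r) f i w) = \sum_(i <- r) \int[P]_w f i w.
Proof.
move=> intf; elim: r => [|i r ih].
  under eq_Rintegral do rewrite big_nil.
  by rewrite big_nil Rintegral_cst// mul0r.
under eq_Rintegral do rewrite big_cons.
rewrite RintegralD//; first by rewrite ih big_cons.
rewrite (_ : _ \o _ = (fun w => \sum_(i <- r) (EFin \o f i) w)%E); last first.
  by apply/funext => w /=; rewrite sumEFin.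
exact: integrable_sum.
Qed.

(** The value is stated in the extended reals so that it also yields finiteness, hence the square
    integrability of Gaussian variables. *)
Lemma integral_sqr_affine_phi m s :
  (\int[mu]_z ((m + s * z) ^+ 2 * phi z)%:E = (m ^+ 2 + s ^+ 2)%:E)%E.
Proof.
have i0 : mu.-integrable [set: R] (EFin \o @phi R) by exact: integrable_normal_pdf.
have i1 : mu.-integrable [set: R] (EFin \o (fun z : R => z * phi z)).
  apply: (@integrable_phiM _ 1) => // z; rewrite mul1r.
  have := real_normK (num_real z); move: `|z| => w <-.
  by have := sqr_ge0 (w - 1); have := sqr_ge0 (w + 1); lra.
have i2 : mu.-integrable [set: R] (EFin \o (fun z : R => z ^+ 2 * phi z)).
  apply: (@integrable_phiM _ 1) => // z.
  by rewrite mul1r ger0_norm ?sqr_ge0// lerDr.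
have i12 : mu.-integrable [set: R]
    (EFin \o (fun z : R => 2 * m * s * (z * phi z) + s ^+ 2 * (z ^+ 2 * phi z))).
  have := integrableD measurableT (integrableZl measurableT (2 * m * s) i1)
    (integrableZl measurableT (s ^+ 2) i2).
  exact.
have fE : \int[mu]_z ((m + s * z) ^+ 2 * phi z) = m ^+ 2 + s ^+ 2.
  transitivity (\int[mu]_z (m ^+ 2 * phi z + (2 * m * s * (z * phi z) + s ^+ 2 * (z ^+ 2 * phi z)))).
    by apply: eq_Rintegral => z _; ring.
  rewrite RintegralD//; last exact: (integrableZl measurableT (m ^+ 2) i0).
  rewrite RintegralD//; last 2 first.
  - exact: (integrableZl measurableT (2 * m * s) i1).
  - exact: (integrableZl measurableT (s ^+ 2) i2).
  by rewrite !RintegralZl// integral_phi integral_id_phi integral_sqr_phi; ring.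
rewrite -fE fineK//; apply: integrable_fin_num => //.
apply: (@integrable_phiM _ ((m ^+ 2 + s ^+ 2) *+ 2)).
  by apply: measurable_funX => //; apply: measurable_funD => //; exact: measurable_funM.
move=> z; rewrite ger0_norm ?sqr_ge0//.
have := sqr_ge0 (m - s * z); have := sqr_ge0 s; have := sqr_ge0 (m * z).
by rewrite exprMn mulr2n; lra.
Qed.

Lemma gaussian_law_moments Y : measurable_fun [set: T] Y ->
  gaussian_law (pushforward P Y) ->
  exists m s : R, [/\ 0 <= s,
    forall A : set R, measurable A ->
      P (Y @^-1` A) = if s == 0 then \d_m A else normal_prob m s A,
    P.-integrable [set: T] (EFin \o (fun w => Y w ^+ 2)),
    \int[P]_w Y w = m /\ \int[P]_w (Y w ^+ 2) = m ^+ 2 + s ^+ 2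
    & forall b, \int[P]_w cos (Y w + b) = cos (m + b) * expR (- (s ^+ 2 / 2))].
Proof.
move=> mY /(gaussian_law_integral mY)[m [s [s0 lawY intY]]].
have sqrY c : (\int[P]_w ((Y w + c) ^+ 2)%:E = ((m + c) ^+ 2 + s ^+ 2)%:E)%E.
  rewrite (intY (fun x => (x + c) ^+ 2)); last by move=> x; exact: sqr_ge0.
    rewrite -integral_sqr_affine_phi; apply: eq_integral => z _.
    by congr ((_ ^+ 2 * _)%:E); ring.
  move=> x; apply/differentiable_continuous/derivable1_diffP.
  exact: ex_derive.
have isqrY c : P.-integrable [set: T] (EFin \o (fun w => (Y w + c) ^+ 2)).
  apply/integrableP; split.
    by apply/measurable_EFinP; apply: measurable_funX; exact: measurable_funD.
  under eq_integral do rewrite /= ger0_norm ?sqr_ge0//.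
  by rewrite sqrY ltry.
have isqr : P.-integrable [set: T] (EFin \o (fun w => Y w ^+ 2)).
  have := isqrY 0; congr (P.-integrable _ (_ \o _)).
  by apply/funext => w; rewrite addr0.
have P1 : fine (P setT) = 1 by rewrite probability_setT.
exists m, s; split => //.
  have RsqrY c : \int[P]_w ((Y w + c) ^+ 2) = (m + c) ^+ 2 + s ^+ 2.
    by rewrite /Rintegral sqrY.
  have Y2 : \int[P]_w (Y w ^+ 2) = m ^+ 2 + s ^+ 2.
    have := RsqrY 0; rewrite addr0 => <-.
    by apply: eq_Rintegral => w _; rewrite addr0.
  split => //.
  (* The mean is recovered from two integrals of squares, since
     [(Y + 1) ^+ 2 - Y ^+ 2 = 2 * Y + 1]. *)
  have -> : \int[P]_w Y w = \int[P]_w (2^-1 * (((Y w + 1) ^+ 2 - Y w ^+ 2) - 1)).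
    by apply: eq_Rintegral => w _; field.
  have iB : P.-integrable [set: T] (EFin \o (fun w => (Y w + 1) ^+ 2 - Y w ^+ 2)).
    exact: (integrableB measurableT (isqrY 1) isqr).
  have ic : P.-integrable [set: T] (EFin \o cst 1) by exact: finite_measure_integrable_cst.
  rewrite RintegralZl//; last exact: (integrableB measurableT iB ic).
  rewrite RintegralB// RintegralB// RsqrY Y2 Rintegral_cst// P1.
  by field.
move=> b.
(* Adding 1 makes the cosine a nonnegative test function; the extra 1 contributes the same amount on
   both sides and cancels at the end. *)
have ccos : continuous (fun x : R => cos (x + b) + 1).
  move=> x; apply/differentiable_continuous/derivable1_diffP.
  exact: ex_derive.
have icos : P.-integrable [set: T] (EFin \o (fun w => cos (Y w + b))).
  apply: (@integrable_bounded 1) => [|w]; last exact: norm_cos_le1.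
  apply: measurableT_comp => //; first exact: continuous_measurable_fun (@continuous_cos R).
  exact: measurable_funD.
have ic : P.-integrable [set: T] (EFin \o cst 1) by exact: finite_measure_integrable_cst.
have cos0 x : 0 <= cos (x + b) + 1 by have := cos_geN1 (x + b); lra.
have := congr1 fine (intY _ ccos cos0).
rewrite -!/(Rintegral _ _ _) RintegralD// Rintegral_cst// P1 mulr1.
have -> : \int[mu]_z ((cos (m + s * z + b) + 1) * phi z) =
    \int[mu]_z (cos (s * z + (m + b)) * phi z + phi z).
  by apply: eq_Rintegral => z _; rewrite mulrDl mul1r; congr (cos _ * _ + _); ring.
rewrite RintegralD//; [|exact: integrable_cos_phi|exact: integrable_normal_pdf].
by rewrite integral_phi integral_cos_phi => /addIr.
Qed.
End gauss_vector.

(** * Covariance matrix and laws of linear combinations *)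

Section standard_gaussian.
Variables (R : realType) (d : measure_display) (T : measurableType d).
Variables (P : probability T R) (n : nat) (X : 'I_n -> {RV P >-> R}).
Hypothesis HX : standard_gaussian_vector X.

Definition lincomb (a : 'I_n -> R) (w : T) : R := \sum_(i < n) a i * X i w.

Definition covmx : 'M[R]_n := \matrix_(i, j) fine (covariance P (X i) (X j)).

Lemma measurable_lincomb a : measurable_fun [set: T] (lincomb a).
Proof. by apply: measurable_sum => i; exact: measurable_funM. Qed.

Let integrable_sqr i : P.-integrable [set: T] (EFin \o (fun w => X i w ^+ 2)).
Proof.
have [gX _] := HX.
have [m [s [_ _ + _ _]]] := gaussian_law_moments (measurable_lincomb _) (gX (fun j => (j == i)%:R)).
congr (P.-integrable _ (_ \o _)); apply/funext => w.
rewrite /lincomb (bigD1 i)//= eqxx mul1r big1 ?addr0// => j /negbTE ->.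
by rewrite mul0r.
Qed.

Let integrable_mul i j : P.-integrable [set: T] (EFin \o (fun w => X i w * X j w)).
Proof.
have := integrableD measurableT (integrable_sqr i) (integrable_sqr j).
apply: le_integrable => //.
  by apply/measurable_EFinP; exact: measurable_funM.
move=> w _; rewrite /comp -EFinD !abse_EFin lee_fin/= normrM.
rewrite [leRHS]ger0_norm ?addr_ge0 ?sqr_ge0//.
rewrite -(real_normK (num_real (X i w))) -(real_normK (num_real (X j w))).
have := sqr_ge0 (`|X i w| - `|X j w|); have := sqr_ge0 (`|X i w| + `|X j w|).
by lra.
Qed.

Let integrable_X i : P.-integrable [set: T] (EFin \o X i).
Proof.
have c1 := finite_measure_integrable_cst P 1 measurableT.
have := integrableD measurableT (integrable_sqr i) c1.
apply: le_integrable => //; first exact/measurable_EFinP.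
move=> w _; rewrite /comp -EFinD !abse_EFin lee_fin/=.
rewrite [leRHS]ger0_norm ?addr_ge0 ?sqr_ge0//.
rewrite -(real_normK (num_real (X i w))).
by have := sqr_ge0 (`|X i w| - 1); have := sqr_ge0 (`|X i w| + 1); lra.
Qed.

Let mean0 i : \int[P]_w X i w = 0.
Proof. by have [_ /(_ i)[+ _]] := HX; rewrite unlock /Rintegral => ->. Qed.

Lemma covmxE i j : covmx i j = \int[P]_w (X i w * X j w).
Proof.
have [_ EV] := HX.
rewrite mxE unlock (EV i).1 (EV j).1 unlock /Rintegral; congr fine.
by apply: eq_integral => w _; rewrite /= !fctE/= !subr0.
Qed.

Lemma covmx_sym : covmx^T = covmx.
Proof. by apply/matrixP => i j; rewrite !mxE covarianceC. Qed.

Lemma covmx_diag i : covmx i i = 1.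
Proof. by rewrite mxE; have [_ /(_ i)[_ ]] := HX; rewrite /variance => ->. Qed.

(** The coordinates are centred, so the combination has mean 0, and expanding its square identifies
    [s ^+ 2] with the quadratic form of the covariance matrix at [a]. A degenerate combination is
    the point mass at 0. *)
Lemma lincomb_law (a : 'rV[R]_n) :
  exists s : R, [/\ 0 <= s, s ^+ 2 = (a *m covmx *m a^T) 0 0,
    forall A : set R, measurable A ->
      P (lincomb (a 0) @^-1` A) = if s == 0 then \d_(0:R) A else normal_prob 0 s A
    & forall b, \int[P]_w cos (lincomb (a 0) w + b) = cos b * expR (- (s ^+ 2 / 2))].
Proof.
have [gX _] := HX.
have [m [s [s0 lawA _ [mean sqr] icos]]] := gaussian_law_moments (measurable_lincomb _) (gX (a 0)).
have m0 : m = 0.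
  rewrite -mean Rintegral_sum; last first.
    by move=> i; exact: (integrableZl measurableT (a 0 i) (integrable_X i)).
  rewrite big1// => i _; rewrite RintegralZl//.
  by rewrite mean0 mulr0.
exists s; split => //.
- move: sqr; rewrite m0 expr0n add0r => <-.
  have -> : \int[P]_w (lincomb (a 0) w ^+ 2) =
      \int[P]_w (\sum_i \sum_j (a 0 i * a 0 j * (X i w * X j w))).
    apply: eq_Rintegral => w _; rewrite expr2 mulr_suml; apply: eq_bigr => i _.
    by rewrite mulr_sumr; apply: eq_bigr => j _; ring.
  have iij i j : P.-integrable [set: T] (EFin \o (fun w => a 0 i * a 0 j * (X i w * X j w))).
    exact: (integrableZl measurableT (a 0 i * a 0 j) (integrable_mul i j)).
  rewrite Rintegral_sum; last first.
    move=> i; rewrite (_ : _ \o _ = (fun w => \sum_j (EFin \o (fun w => (a 0 i * a 0 j * (X i w * X j w))%R)) w)%E).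
      exact: integrable_sum.
    by apply/funext => w /=; rewrite sumEFin.
  under eq_bigr => i _ do rewrite Rintegral_sum//.
  rewrite exchange_big mxE; apply: eq_bigr => j _.
  rewrite !mxE mulr_suml; apply: eq_bigr => i _.
  by rewrite RintegralZl// -covmxE; ring.
- by move=> A mA; rewrite lawA// m0.
- by move=> b; rewrite icos m0 add0r.
Qed.

End standard_gaussian.

(** * Full support of nondegenerate Gaussian vectors *)

(** Induction on the size: one step of symmetric Gaussian elimination splits off the pivot [al] and
    leaves its Schur complement [S'], which is again symmetric and positive definite. *)
Lemma posdef_diagonalize (F : rcfType) (n : nat) (C : 'M[F]_n) : C^T = C ->
  (forall a : 'rV[F]_n, a != 0 -> 0 < (a *m C *m a^T) 0 0) ->
  exists B : 'M[F]_n, B *m C *m B^T = 1%:M.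
Proof.
elim: n C => [|n IH] C symC posC; first by exists 1%:M; apply/matrixP => -[].
move: C symC posC; rewrite -[n.+1]/(1 + n)%N => C symC posC.
pose al := C 0 0; pose v : 'rV[F]_n := ursubmx C; pose S := drsubmx C.
have CE : C = block_mx al%:M v v^T S.
  rewrite -[LHS]submxK; congr block_mx; first by rewrite [LHS]mx11_scalar !mxE lshift0.
  by rewrite /v trmx_ursub symC.
have symS : S^T = S by rewrite /S trmx_drsub symC.
have al0 : 0 < al.
  have /posC : (delta_mx 0 0 : 'rV[F]_(1 + n)) != 0.
    by apply/eqP => /matrixP/(_ 0 0)/eqP; rewrite !mxE eqxx oner_eq0.
  by rewrite -rowE trmx_delta -colE !mxE.
(* [L] subtracts from the lower rows the multiples of the first row that clear the first column. *)
pose L : 'M[F]_(1 + n) := block_mx 1%:M 0 (- al^-1 *: v^T) 1%:M.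
pose S' := S - al^-1 *: (v^T *m v).
have LCL : L *m C *m L^T = block_mx al%:M 0 0 S'.
  rewrite CE /L tr_block_mx !mulmx_block !trmx1 trmx0 linearZ/= trmxK.
  rewrite !mul1mx !mul0mx !mulmx0 !mulmx1 !addr0 -!scalemxAl !mul_mx_scalar !scalerA.
  rewrite mul_scalar_mx scalerA mulNr mulrN mulVf ?mulfV ?gt_eqF//.
  by rewrite !scaleN1r !addNr mul0mx add0r scaleNr addrC.
have LCLM k (M : 'M[F]_(k, 1 + n)) :
    M *m L *m C *m (M *m L)^T = M *m block_mx al%:M 0 0 S' *m M^T.
  by rewrite -LCL trmx_mul !mulmxA.
have unitL : L \in unitmx.
  by rewrite unitmxE /L det_lblock !det1 mulr1 unitr1.
have [||B' B'S] := IH S'.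
- by rewrite /S' linearB/= linearZ/= trmx_mul trmxK symS.
(* The form of [S'] at [b] is the form of [C] at [r *m L], which is nonzero because [L] is
   invertible. *)
- move=> b b0; pose r : 'rV_(1 + n) := row_mx 0 b.
  have /posC : r *m L != 0.
    apply: contra_neq b0 => /(congr1 (mulmx^~ (invmx L))).
    rewrite mulmxK// mul0mx => r0.
    by have := congr1 rsubmx r0; rewrite row_mxKr linear0.
  rewrite LCLM /r tr_row_mx mul_row_block mul_row_col trmx0.
  by rewrite !mul0mx !mulmx0 !add0r.
pose D : 'M[F]_(1 + n) := block_mx (Num.sqrt al)^-1%:M 0 0 B'.
exists (D *m L).
rewrite LCLM /D tr_block_mx !mulmx_block !trmx0 tr_scalar_mx.
rewrite !(mul0mx, mulmx0, addr0, add0r) B'S -!scalar_mxM.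
rewrite mulrAC -invfM -expr2 sqr_sqrtr ?ltW// mulVf ?gt_eqF//.
by rewrite scalar_mx_block.
Qed.

(** * Gaussian-weighted cosine integrals and exchange of averages *)

Section kernel.
Variables (R : realType) (d : measure_display) (T : measurableType d).
Variable P : probability T R.
Implicit Types (s t x z b m c : R).
Notation mu := (@lebesgue_measure R).

Lemma integral_cos_normal_pdf (sg s b : R) : 0 < sg ->
  \int[mu]_z (cos (s * z + b) * normal_pdf 0 sg z) = cos b * expR (- ((s * sg) ^+ 2 / 2)).
Proof.
move=> sg0.
have ccos : continuous (fun x : R => cos (s * x + b) + 1).
  move=> x; apply/differentiable_continuous/derivable1_diffP.
  exact: ex_derive.
have cos0 x : 0 <= cos (s * x + b) + 1 by have := cos_geN1 (s * x + b); lra.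
have := integral_normal_prob_affine 0 sg0 ccos cos0.
rewrite ge0_integral_normal_prob//; last exact: continuous_measurable_fun.
move=> /(congr1 fine); rewrite -!/(Rintegral _ _ _).
have ipdf := integrable_normal_pdf 0 sg.
have -> : \int[mu]_z ((cos (s * z + b) + 1) * normal_pdf 0 sg z) =
    \int[mu]_z (cos (s * z + b) * normal_pdf 0 sg z + normal_pdf 0 sg z).
  by apply: eq_Rintegral => z _; rewrite mulrDl mul1r.
rewrite RintegralD//; last first.
  move: ipdf; apply: le_integrable => //.
    apply/measurable_EFinP/measurable_funM; last exact: measurable_normal_pdf.
    apply: measurableT_comp; first exact: continuous_measurable_fun (@continuous_cos R).
    by apply: measurable_funD => //; exact: measurable_funM.
  move=> z _; rewrite /comp !abse_EFin lee_fin normrM.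
  by rewrite ler_piMl// norm_cos_le1.
have -> : \int[mu]_z ((cos (s * (0 + sg * z) + b) + 1) * phi z) =
    \int[mu]_z (cos (s * sg * z + b) * phi z + phi z).
  apply: eq_Rintegral => z _; rewrite mulrDl mul1r; congr (cos _ * _ + _); ring.
rewrite RintegralD//; [|exact: integrable_cos_phi|exact: integrable_normal_pdf].
rewrite integral_phi integral_cos_phi {2}/Rintegral integral_normal_pdf.
exact: addIr.
Qed.

(** The two Gaussian factors combine into the exponent [- (1 + t ^+ 2) * z ^+ 2 / 2], that is, [sg]
    times the normal density of deviation [sg]. *)
Lemma integral_gauss_cos_phi (t s b : R) (sg := (Num.sqrt (1 + t ^+ 2))^-1) :
  \int[mu]_z (expR (- ((t * z) ^+ 2 / 2)) * cos (s * z + b) * phi z) =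
  sg * (cos b * expR (- ((s * sg) ^+ 2 / 2))).
Proof.
have t1 : 0 < 1 + t ^+ 2 by rewrite ltr_pwDl// sqr_ge0.
have sg0 : 0 < sg by rewrite invr_gt0 sqrtr_gt0.
rewrite -integral_cos_normal_pdf// -RintegralZl//; last first.
  have := integrable_normal_pdf 0 sg; apply: le_integrable => //.
    apply/measurable_EFinP/measurable_funM; last exact: measurable_normal_pdf.
    apply: measurableT_comp; first exact: continuous_measurable_fun (@continuous_cos R).
    by apply: measurable_funD => //; exact: measurable_funM.
  move=> z _; rewrite /comp !abse_EFin lee_fin normrM.
  by rewrite ler_piMl// norm_cos_le1.
apply: eq_Rintegral => z _.
suff key : expR (- ((t * z) ^+ 2 / 2)) * phi z = sg * normal_pdf 0 sg z.
  by rewrite mulrAC key; ring.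
rewrite phiE /normal_pdf gt_eqF// /normal_fun /normal_peak subr0.
rewrite expr1n mul1r -mulrnAr sqrtrM ?sqr_ge0// sqrtr_sqr gtr0_norm//.
rewrite mulrCA -expRD invfM !mulrA mulfV ?mul1r ?gt_eqF//.
congr (_ * expR _); rewrite /sg exprVn sqr_sqrtr ?ltW//.
by field; rewrite gt_eqF.
Qed.

(** Fubini applies because the integrand is dominated by [phi], of mass one, and [P] is a
    probability. *)
Lemma Rintegral_phi_Fubini (f : T * measurableTypeR R -> R) : measurable_fun [set: T * measurableTypeR R] f ->
  (forall w, `|f w| <= 1) ->
  \int[P]_w \int[mu]_y (f (w, y) * phi y) = \int[mu]_y ((\int[P]_w f (w, y)) * phi y).
Proof.
move=> mf f1.
pose F (u : T * measurableTypeR R) := (f u * phi u.2)%:E.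
have mF : measurable_fun [set: T * measurableTypeR R] F.
  apply/measurable_EFinP; apply: measurable_funM => //.
  by apply: measurableT_comp => //; exact: measurable_phi.
have intF w : mu.-integrable [set: R] (fun y => F (w, y)).
  have := integrable_normal_pdf (0 : R) 1; apply: le_integrable => //.
    by apply: measurableT_comp => //; exact: measurable_pair1.
  move=> y _; rewrite /F !abse_EFin lee_fin/= normrM.
  by rewrite ler_piMl.
have mfy y : measurable_fun [set: T] (fun w => f (w, y)).
  by apply: measurableT_comp => //; exact: measurable_pair2.
have intfy y : P.-integrable [set: T] (EFin \o (fun w => f (w, y))).
  by apply: (@integrable_bounded _ _ _ _ 1).
have prodF : (P \x mu)%E.-integrable [set: T * measurableTypeR R] F.
  apply/integrable12ltyP => //.
  apply: (@le_lt_trans _ _ (\int[P]_w 1)%E); last first.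
    by rewrite integral_cst// mul1e -ge0_fin_numE// fin_num_measure.
  apply: ge0_le_integral => //.
  - by move=> w _; exact: integral_ge0.
  - have mF' : measurable_fun setT (abse \o F) by apply: measurableT_comp.
    exact: (@measurable_fun_fubini_tonelli_F _ _ _ _ _ mu _ mF' (fun=> abse_ge0 _)).
  - move=> w _; rewrite -(integral_normal_pdf (0 : R) 1); apply: ge0_le_integral => //.
    + by apply: measurableT_comp => //; exact: measurable_int (intF w).
    + by apply/measurable_EFinP; exact: measurable_normal_pdf.
    + by move=> y _; rewrite /F abse_EFin lee_fin/= normrM (ger0_norm (phi_ge0 y)) ler_piMl ?phi_ge0.
have := congr1 fine (Fubini prodF); rewrite /Rintegral => FF.
transitivity (fine (\int[P]_w \int[mu]_y F (w, y))%E).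
  congr fine; apply: eq_integral => w _; rewrite fineK//.
  exact: integrable_fin_num (intF w).
rewrite FF; congr fine; apply: eq_integral => y _.
rewrite EFinM fineK; last exact: integrable_fin_num (intfy y).
by rewrite -integralZr//; exact: intfy.
Qed.

End kernel.

Lemma measurable_box (R : realType) (d : measure_display) (T : measurableType d)
    (n : nat) (f : 'I_n -> T -> R) (z : 'I_n -> R) (e : R) :
  (forall i, measurable_fun [set: T] (f i)) ->
  measurable [set w | forall i, `|f i w - z i| < e].
Proof.
move=> mf.
rewrite (_ : mkset _ = \bigcap_(i in [set: 'I_n]) [set w | `|f i w - z i| < e]); last first.
  by apply/seteqP; split => [w Sw i _|w Sw i]; exact: Sw.
apply: fin_bigcap_measurable => // i _.
have mi : measurable_fun [set: T] (fun w => `|f i w - z i|).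
  by apply: measurableT_comp => //; exact: measurable_funB.
rewrite (_ : [set w | _] = [set: T] `&` (fun w => `|f i w - z i|) @^-1` `]-oo, e[); last first.
  by rewrite setTI; apply/seteqP; split => w /=; rewrite in_itv.
by apply: mi => //; exact: measurable_itv.
Qed.

(** * Positive mass of small boxes for a vector with the standard normal transform *)

Section small_ball.
Variables (R : realType) (d : measure_display) (T : measurableType d).
Variables (P : probability T R) (n : nat) (Z : 'I_n -> T -> R).
Hypothesis mZ : forall i, measurable_fun [set: T] (Z i).
(** The characteristic function of a standard normal vector in real form; varying the phase [b]
    captures both its real and its imaginary part. *)
Hypothesis charZ : forall (a : 'I_n -> R) b,
  \int[P]_w cos (\sum_i a i * Z i w + b) =
  cos b * expR (- ((\sum_i a i ^+ 2) / 2)).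
Notation mu := (@lebesgue_measure R).

(* Each factor exp (- (t u)^2 / 2) is the average of cos (t u y) over a standard
   normal y; trading the factors for such averages one at a time reduces the
   claim to [charZ], and [sg * expR _] is what the outer y-integral leaves. *)
Lemma integral_prod_gauss_cos (t : R) (z : 'I_n -> R)
    (sg := (Num.sqrt (1 + t ^+ 2))^-1) (k : nat) : (k <= n)%N ->
  forall (a : 'I_n -> R) b, (forall i : 'I_n, (i < k)%N -> a i = 0) ->
  \int[P]_w ((\prod_(i < n | (i < k)%N) expR (- ((t * (Z i w - z i)) ^+ 2 / 2))) *
     cos (\sum_i a i * Z i w + b)) =
  (\prod_(i < n | (i < k)%N) (sg * expR (- ((t * z i * sg) ^+ 2 / 2)))) *
    (cos b * expR (- ((\sum_i a i ^+ 2) / 2))).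
Proof.
elim: k => [|k IH] kn a b a0.
  rewrite big_pred0// mul1r -charZ; apply: eq_Rintegral => w _.
  by rewrite big_pred0// mul1r.
pose o := Ordinal kn.
have ko (i : 'I_n) : (i < k.+1)%N && (i != o) = (i < k)%N.
  by rewrite ltnS ltn_neqAle andbC.
pose G w := \prod_(i < n | (i < k)%N) expR (- ((t * (Z i w - z i)) ^+ 2 / 2)).
pose c := \prod_(i < n | (i < k)%N) (sg * expR (- ((t * z i * sg) ^+ 2 / 2))).
pose A w := \sum_i a i * Z i w + b.
(* The random frequency [t * y] is placed at coordinate [o], where [a] vanishes, so the squared
   norms simply add. *)
pose a' y i := a i + (i == o)%:R * (t * y).
have a'E y w : \sum_i a' y i * Z i w = \sum_i a i * Z i w + t * y * Z o w.
  transitivity (\sum_i (a i * Z i w + (i == o)%:R * (t * y * Z i w))).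
    by apply: eq_bigr => i _; rewrite /a'; ring.
  rewrite big_split/=; congr (_ + _); rewrite (bigD1 o)//= eqxx mul1r big1 ?addr0// => i /negbTE ->.
  by rewrite mul0r.
have a'sqr y : \sum_i a' y i ^+ 2 = \sum_i a i ^+ 2 + (t * y) ^+ 2.
  rewrite (bigD1 o)//= [in RHS](bigD1 o)//= /a' eqxx a0 ?ltnSn// expr0n add0r add0r mul1r addrC.
  by congr (_ + _); apply: eq_bigr => i /negbTE ->; rewrite mul0r addr0.
transitivity (\int[P]_w \int[mu]_y (G w * cos (t * y * (Z o w - z o) + A w) * phi y)).
  apply: eq_Rintegral => w _; rewrite (bigD1 o)//= (eq_bigl _ _ ko) -/(G w) -/(A w).
  transitivity (G w * \int[mu]_y (cos (t * (Z o w - z o) * y + A w) * phi y)).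
    by rewrite integral_cos_phi; ring.
  rewrite -RintegralZl//; last exact: integrable_cos_phi.
  apply: eq_Rintegral => y _; rewrite mulrA; congr (_ * cos (_ + _) * _); ring.
pose f (u : T * measurableTypeR R) := G u.1 * cos (t * u.2 * (Z o u.1 - z o) + A u.1).
have mG : measurable_fun [set: T] G.
  rewrite /G; under eq_fun do rewrite big_mkcond/=.
  apply: measurable_prod => i _; case: (i < k)%N => //; apply: measurableT_comp => //.
  apply: measurableT_comp => //; apply: measurable_funM => //.
  apply: measurable_funX; apply: measurable_funM => //.
  exact: measurable_funB.
have mf : measurable_fun [set: T * measurableTypeR R] f.
  have m1 : measurable_fun [set: T * measurableTypeR R] (fun u => u.1) by exact: measurable_fst.
  have m2 : measurable_fun [set: T * measurableTypeR R] (fun u => u.2 : R) by exact: measurable_snd.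
  apply: measurable_funM; first exact: (measurableT_comp mG).
  apply: measurableT_comp; first exact: continuous_measurable_fun (@continuous_cos R).
  apply: measurable_funD.
    apply: measurable_funM; first exact: measurable_funM.
    by apply: measurable_funB => //; exact: (measurableT_comp (mZ o)).
  apply: (measurableT_comp (f := A)) => //; apply: measurable_funD => //.
  by apply: measurable_sum => i; exact: measurable_funM.
have G1 w : 0 <= G w <= 1.
  rewrite prodr_ge0 => [|i _]; last exact: expR_ge0.
  by apply: prodr_ile1 => i _; rewrite expR_ge0 expR_le1 oppr_le0 divr_ge0// sqr_ge0.
have f1 u : `|f u| <= 1.
  have /andP[G0 G1'] := G1 u.1.
  by rewrite /f normrM ger0_norm// mulr_ile1// norm_cos_le1.
have := Rintegral_phi_Fubini P mf f1; rewrite /f/= => ->.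
rewrite (bigD1 o)//= (eq_bigl _ _ ko) -/c.
transitivity (\int[mu]_y (c * expR (- ((\sum_i a i ^+ 2) / 2)) *
    (expR (- ((t * y) ^+ 2 / 2)) * cos (- (t * z o) * y + b) * phi y))).
  apply: eq_Rintegral => y _.
  transitivity ((\int[P]_w (G w * cos (\sum_i a' y i * Z i w + (b - t * y * z o)))) * phi y).
    congr (_ * _); apply: eq_Rintegral => w _; rewrite a'E /A; congr (_ * cos _); ring.
  rewrite IH; last 2 first.
  - exact: ltnW.
  - move=> i ik; rewrite /a' a0 ?(ltn_trans ik)// add0r.
    by rewrite (_ : i == o = false) ?mul0r//; apply/negbTE; rewrite -ko in ik; case/andP: ik.
  rewrite a'sqr -/c mulrDl opprD expRD.
  have -> : b - t * y * z o = - (t * z o) * y + b by ring.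
  by ring.
rewrite RintegralZl//; last first.
  apply: (@integrable_phiM _ 1).
    apply: measurable_funM.
      apply: measurableT_comp => //; apply: measurableT_comp => //; apply: measurable_funM => //.
      by apply: measurable_funX; exact: measurable_funM.
    apply: measurableT_comp; first exact: continuous_measurable_fun (@continuous_cos R).
    by apply: measurable_funD => //; exact: measurable_funM.
  move=> y; rewrite mul1r (@le_trans _ _ 1)//; last by rewrite lerDl sqr_ge0.
  rewrite normrM mulr_ile1// ?norm_cos_le1// ger0_norm ?expR_ge0//.
  by rewrite expR_le1 oppr_le0 divr_ge0// sqr_ge0.
rewrite integral_gauss_cos_phi -/sg mulNr sqrrN.
by ring.
Qed.

(** If the box were null, the expected product of Gaussian factors with [t ^+ 2 = u] would be at
    most [expR (- (u * e ^+ 2 / 2))], while its exact value is at least a constant times the power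
    [- n / 2] of [1 + u]. Squaring gives [bound], which fails for large [u]. *)
Lemma small_ball_gt0 (z : 'I_n -> R) (e : R) : 0 < e ->
  (0 < P [set w | forall i, (`|Z i w - z i| < e)%R])%E.
Proof.
move=> e0; set S := [set w | _].
have mS : measurable S by exact: measurable_box.
rewrite lt0e measure_ge0 andbT; apply/negP => /eqP PS0.
pose C := \sum_i z i ^+ 2.
have bound (u : R) : 0 <= u -> expR (u * e ^+ 2 - C) <= (1 + u) ^+ n.
  move=> u0; pose t := Num.sqrt u; have tu : t ^+ 2 = u by rewrite sqr_sqrtr.
  pose sg := (Num.sqrt (1 + t ^+ 2))^-1.
  have u1 : 0 < 1 + u by rewrite ltr_pwDl.
  have sg0 : 0 < sg by rewrite invr_gt0 sqrtr_gt0 tu.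
  have sg2 : sg ^+ 2 = (1 + u)^-1 by rewrite /sg tu exprVn sqr_sqrtr// ltW.
  pose G w := \prod_(i < n) expR (- ((t * (Z i w - z i)) ^+ 2 / 2)).
  have mG : measurable_fun [set: T] G.
    apply: measurable_prod => i _; apply: measurableT_comp => //.
    apply: measurableT_comp => //; apply: measurable_funM => //.
    apply: measurable_funX; apply: measurable_funM => //.
    exact: measurable_funB.
  have K1 i w : 0 <= expR (- ((t * (Z i w - z i)) ^+ 2 / 2)) <= 1.
    by rewrite expR_ge0 expR_le1 oppr_le0 divr_ge0// sqr_ge0.
  have G0 w : 0 <= G w by apply: prodr_ge0 => i _; case/andP: (K1 i w).
  have G1 w : `|G w| <= 1 by rewrite ger0_norm// prodr_ile1.
  pose I := \int[P]_w G w.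
  have IE : I = \prod_(i < n) (sg * expR (- ((t * z i * sg) ^+ 2 / 2))).
    have ltn (i : 'I_n) : (i < n)%N = true by rewrite ltn_ord.
    have := @integral_prod_gauss_cos t z n (leqnn n) (fun=> 0) 0 (fun _ _ => erefl).
    rewrite -/sg cos0 mul1r (eq_bigl _ _ ltn).
    rewrite [X in expR (- (X / 2))]big1 ?mul0r ?oppr0 ?expR0 ?mulr1; last first.
      by move=> i _; rewrite expr0n.
    move=> <-; apply: eq_Rintegral => w _.
    have -> : \sum_i 0 * Z i w = 0 by rewrite big1// => i _; rewrite mul0r.
    by rewrite (eq_bigl _ _ ltn) addr0 cos0 mulr1.
  (* Off [S] some coordinate is at distance at least [e] from its target, and that factor alone
     gives the bound; on the null set [S] the product is at most 1. *)
  have I_le : I <= expR (- (u * e ^+ 2 / 2)).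
    rewrite -lee_fin /I /Rintegral fineK; last first.
      apply: integrable_fin_num => //.
      exact: (integrable_bounded P mG G1).
    apply: (@le_trans _ _ (\int[P]_w ((expR (- (u * e ^+ 2 / 2)))%:E + (\1_S w)%:E))%E).
      apply: ge0_le_integral => //.
      - by move=> w _; rewrite lee_fin.
      - by apply/measurable_EFinP.
      - by apply: emeasurable_funD => //; apply/measurable_EFinP; exact: measurable_indic.
      - move=> w _; rewrite -EFinD lee_fin.
        have [Sw|/existsNP[i /negP]] := pselect (S w).
          rewrite indicE mem_set// -[leLHS]add0r lerD ?expR_ge0//.
          exact: prodr_ile1.
        rewrite -leNgt => ei.
        rewrite (@le_trans _ _ (expR (- (u * e ^+ 2 / 2))))//; last by rewrite lerDl.
        rewrite /G (bigD1 i)//= (le_trans (ler_piMr _ _)) ?expR_ge0// ?prodr_ile1//.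
        rewrite ler_expR lerN2 ler_wpM2r// exprMn tu ler_wpM2l//.
        by rewrite -(real_normK (num_real (_ - _))) lerXn2r ?nnegrE ?(ltW e0).
    rewrite ge0_integralD//=; last by apply/measurable_EFinP; exact: measurable_indic.
    rewrite integral_indic// setIT integral_cst//=.
    have -> : P setT = 1%E by exact: probability_setT.
    by have -> : P S = 0%E by []; rewrite adde0 mule1.
  (* Each remaining exponent is controlled by [u / (1 + u) <= 1], so the exponential factors stay
     bounded below uniformly in [u]. *)
  have I_ge : expR (- (C / 2)) * sg ^+ n <= I.
    rewrite IE big_split/= prodr_const card_ord.
    rewrite mulrC ler_wpM2l ?exprn_ge0 ?(ltW sg0)// -expR_sum ler_expR sumrN lerN2.
    rewrite mulr_suml ler_sum// => i _; rewrite ler_wpM2r// exprMn sg2 exprMn tu.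
    by rewrite ler_pdivrMr// mulrC ler_wpM2l ?sqr_ge0// lerDr.
  have := le_trans I_ge I_le.
  rewrite -(@ler_pXn2r _ 2)// ?nnegrE ?mulr_ge0 ?exprn_ge0 ?expR_ge0 ?(ltW sg0)//.
  rewrite exprMn exprAC sg2 -!expRM_natl exprVn ler_pdivrMr ?exprn_gt0//.
  move=> h; rewrite expRD mulrC.
  have -> : expR (u * e ^+ 2) = (expR (2 * - (u * e ^+ 2 / 2)))^-1.
    by rewrite -expRN; congr expR; field.
  rewrite ler_pdivrMr ?expR_gt0// mulrC (le_trans _ h)// ler_expR.
  by rewrite le_eqVlt; apply/orP; left; apply/eqP; field.
(* For [u >= 1], [bound] with [(1 + u) ^+ n <= (2 * u) ^+ n] and the Taylor term of order [n.+1] of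
   the exponential force [u <= K]; the choice [u = K + 1] contradicts this. *)
pose K := (n.+1)`!%:R * 2 ^+ n * expR C / (e ^+ 2) ^+ n.+1.
have e2 : 0 < e ^+ 2 by rewrite exprn_gt0.
have K0 : 0 <= K by rewrite !mulr_ge0 ?invr_ge0 ?expR_ge0 ?exprn_ge0 ?ltW.
pose u := K + 1.
have u1 : 1 <= u by rewrite lerDr.
have u0 : 0 < u by lra.
have := expR_ge1Dxn n (ltW (mulr_gt0 u0 e2)).
have h1 : expR (u * e ^+ 2) <= expR C * (2 * u) ^+ n.
  rewrite -ler_pdivrMl ?expR_gt0// -expRN -expRD addrC (le_trans (bound _ (ltW u0)))//.
  by apply: lerXn2r; rewrite ?nnegrE; lra.
move=> h2; have {}h2 := le_trans (le_trans (ler_wpDl ler01 (lexx _)) h2) h1.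
have un : 0 < u ^+ n * (e ^+ 2) ^+ n.+1 by rewrite mulr_gt0 ?exprn_gt0.
move: h2; rewrite ler_pdivrMr ?ltr0n ?fact_gt0// [(u * _) ^+ _]exprMn [(2 * u) ^+ _]exprMn.
rewrite [leLHS](_ : _ = u ^+ n * (e ^+ 2) ^+ n.+1 * u); last by rewrite [u ^+ n.+1]exprS; ring.
rewrite [leRHS](_ : _ = u ^+ n * (e ^+ 2) ^+ n.+1 * K); last first.
  have KE : K * (e ^+ 2) ^+ n.+1 = (n.+1)`!%:R * 2 ^+ n * expR C.
    by rewrite /K divfK ?gt_eqF ?exprn_gt0.
  by rewrite -[RHS]mulrA [_ * K]mulrC KE; ring.
by rewrite ler_pM2l// /u gerDl ler10.
Qed.
End small_ball.

(** * Transfer of small boxes to open sets of row vectors *)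

Section full_support.
Variables (R : realType) (d : measure_display) (T : measurableType d).
Variables (P : probability T R) (n : nat) (X : 'I_n -> {RV P >-> R}).

Let rX w : 'rV[R]_n := \row_(i < n) X i w.

Lemma open_rV_box (U : set 'rV[R]_n) (x : 'rV[R]_n) : open U -> U x ->
  exists2 e : R, 0 < e & forall y : 'rV[R]_n, (forall i, `|y 0 i - x 0 i| < e) -> U y.
Proof.
move=> oU Ux; have /nbhs_ballP[e /= e0 eU] := open_nbhs_nbhs (conj oU Ux).
exists e => // y yx; apply: eU; split => // i j; rewrite ord1.
by rewrite -ball_normE/= distrC; exact: yx.
Qed.

(** An open set is the union of the boxes with rational centre and radius [k.+1%:R^-1] that it
    contains, and there are countably many of them. *)
Lemma measurable_open_preimage (U : set 'rV[R]_n) : open U ->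
  measurable (rX @^-1` U).
Proof.
move=> oU.
pose box (q : 'rV[rat]_n) (k : nat) :=
  [set y : 'rV[R]_n | forall i, `|y 0 i - ratr (q 0 i)| < k.+1%:R^-1].
pose F (u : 'rV[rat]_n * nat) : set T :=
  if `[< box u.1 u.2 `<=` U >] then rX @^-1` box u.1 u.2 else set0.
have -> : rX @^-1` U = \bigcup_u F u.
  apply/seteqP; split => [w Uw|w [[q k] _]]; last first.
    by rewrite /F; case: asboolP => //= qU; exact: qU.
  have [e e0 eU] := open_rV_box oU Uw.
  (* Radius below [e / 2]: a point of the box is within one radius of the centre, itself within one
     radius of the given point. *)
  have [k ke] : exists k, k.+1%:R^-1 < e / 2.
    exists (Num.trunc (e / 2)^-1); rewrite invf_plt ?posrE ?divr_gt0//.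
    exact: Num.Theory.truncnS_gt.
  have qx i : exists q : rat, `|X i w - ratr q| < k.+1%:R^-1.
    have [] := @rat_in_itvoo R (X i w - k.+1%:R^-1) (X i w + k.+1%:R^-1).
      by rewrite ltrBlDr -addrA ltrDl addr_gt0.
    move=> q; rewrite in_itv/= => /andP[q1 q2]; exists q.
    move: q1 q2; move: (ratr q) (X i w) (k.+1%:R^-1) => a b c.
    by rewrite ltr_norml => ? ?; apply/andP; split; lra.
  have [q qP] := choice qx.
  exists (\row_i q i, k) => //; rewrite /F/=; case: asboolP => [_ i|].
    by rewrite !mxE.
  case=> y yq; apply: eU => i; have := yq i; have := qP i; rewrite !mxE.
  move: ke; move: (ratr (q i)) (X i w) (k.+1%:R^-1) (y 0 i) => a b c z ke.
  by rewrite !ltr_norml => /andP[? ?] /andP[? ?]; apply/andP; split; lra.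
apply: countable_bigcupT_measurable => [|[q k]]; first exact: countableP.
rewrite /F; case: asboolP => //= _.
rewrite (_ : _ @^-1` _ = [set w | forall i, `|X i w - ratr (q 0 i)| < k.+1%:R^-1]).
  exact: measurable_box.
by apply/seteqP; split => w /= wq i; have := wq i; rewrite mxE.
Qed.

Hypothesis HX : standard_gaussian_vector X.

(** [Z = B X] has identity covariance, hence satisfies the hypothesis of the small-box estimate; the
    inverse of [B] carries a small enough box for [Z] into any prescribed box for [X]. *)
Lemma fully_supported_diagonalizable (B : 'M[R]_n) :
  B *m covmx X *m B^T = 1%:M -> fully_supported X.
Proof.
move=> BC; pose Z i := lincomb X (B i).
have charZ (a : 'I_n -> R) b : \int[P]_w cos (\sum_i a i * Z i w + b) =
    cos b * expR (- ((\sum_i a i ^+ 2) / 2)).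
  pose r : 'rV[R]_n := \row_i a i.
  have [s [_ sE _ lawB]] := lincomb_law HX (r *m B).
  have -> : \sum_i a i ^+ 2 = s ^+ 2.
    rewrite sE.
    have -> : r *m B *m covmx X *m (r *m B)^T = r *m (B *m covmx X *m B^T) *m r^T.
      by rewrite trmx_mul !mulmxA.
    by rewrite BC mulmx1 mxE; apply: eq_bigr => i _; rewrite !mxE expr2.
  rewrite -lawB; apply: eq_Rintegral => w _; congr (cos (_ + _)).
  rewrite /Z /lincomb; under eq_bigr do rewrite mulr_sumr.
  rewrite exchange_big; apply: eq_bigr => j _.
  by rewrite !mxE mulr_suml; apply: eq_bigr => i _; rewrite !mxE mulrA.
have unitB : B \in unitmx.
  by have /mulmx1_unit[] : B *m (covmx X *m B^T) = 1%:M by rewrite mulmxA.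
apply/seteqP; split => // x _ U oU Ux.
have [e e0 eU] := open_rV_box oU Ux.
pose V := invmx B.
(* [K] dominates every absolute row sum of the inverse of [B]; [K + 1] is positive and makes the
   final inequality strict. *)
pose K := \sum_j \sum_i `|V j i|.
have K1 : 0 < K + 1.
  by rewrite ltr_wpDl// sumr_ge0// => j _; rewrite sumr_ge0.
pose z i := (B *m x^T) i 0.
have mZ i : measurable_fun [set: T] (Z i) by exact: measurable_lincomb.
apply: (lt_le_trans (small_ball_gt0 mZ charZ z (divr_gt0 e0 K1))).
apply: le_measure; rewrite ?inE.
- exact: measurable_box.
- exact: measurable_open_preimage.
move=> w /= wz; apply: eU => j.
have XZ : X j w - x 0 j = \sum_i V j i * (Z i w - z i).
  have -> : X j w = (V *m (B *m (rX w)^T)) j 0 by rewrite mulKmx// !mxE.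
  have -> : x 0 j = (V *m (B *m x^T)) j 0 by rewrite mulKmx// !mxE.
  rewrite [in LHS]mxE [X in _ - X]mxE -sumrB; apply: eq_bigr => i _.
  rewrite -mulrBr; congr (_ * (_ - _)).
  by rewrite mxE; apply: eq_bigr => k _; rewrite !mxE.
rewrite mxE XZ (le_lt_trans (ler_norm_sum _ _ _))//.
apply: (@le_lt_trans _ _ (\sum_i `|V j i| * (e / (K + 1)))).
  by apply: ler_sum => i _; rewrite normrM ler_wpM2l// ltW.
rewrite -mulr_suml mulrA ltr_pdivrMr// mulrC ltr_pM2l//.
apply: (@le_lt_trans _ _ K); last by rewrite ltrDl.
rewrite /K [leRHS](bigD1 j)//= lerDl.
by rewrite sumr_ge0// => k _; rewrite sumr_ge0.
Qed.
End full_support.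

(** * Gaussian tails *)

Section tails.
Variable R : realType.
Implicit Types (s h e : R).
Notation mu := (@lebesgue_measure R).

(** On the unit interval after [h] the density is at least its value [m] at the right endpoint. *)
Lemma normal_tail_gt0 h : 0 <= h -> (0 < normal_prob 0 1 `]h, +oo[)%E.
Proof.
move=> h0; have p0 : 0 < normal_peak 1 :> R by rewrite normal_peak_gt0 ?oner_eq0.
pose m : R := normal_peak 1 * expR (- ((h + 1) ^+ 2 / 2)).
have m0 : 0 < m by rewrite mulr_gt0 ?expR_gt0.
apply: (@lt_le_trans _ _ (\int[mu]_(x in `]h, (h + 1)%R[) m%:E)%E).
  rewrite integral_cst//= lebesgue_measure_itv/= lte_fin ltrDl ltr01.
  by rewrite -EFinB mule_gt0// lte_fin; lra.
have mpdf A : measurable A -> measurable_fun A (fun x : measurableTypeR R => (normal_pdf 0 1 x)%:E).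
  by move=> mA; apply: measurable_funTS; apply/measurable_EFinP; exact: measurable_normal_pdf.
apply: (@le_trans _ _ (normal_prob 0 1 `]h, h + 1[)).
  apply: ge0_le_integral => //.
  - by move=> x _; rewrite lee_fin ltW.
  - exact: mpdf.
  - move=> x; rewrite /= in_itv/= => /andP[hx xh].
    rewrite lee_fin -/(phi x) phiE ler_pM2l// ler_expR lerN2 ler_wpM2r//.
    by rewrite lerXn2r ?nnegrE//; lra.
apply: le_measure; rewrite ?inE; [exact: measurable_itv|exact: measurable_itv|].
by apply: subset_itvl; rewrite bnd_simp.
Qed.

(** The ratio of the two densities is [s^-1 * expR (- ((s ^- 2 - 1) * x ^+ 2 / 2))], nonincreasing
    for [x >= 0] as [s < 1], so its value at [h] bounds it beyond [h]. *)
Lemma normal_pdf_tail_le s h x : 0 < s < 1 -> 0 <= h <= x ->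
  normal_pdf 0 s x <= s^-1 * expR (- ((s ^- 2 - 1) * h ^+ 2 / 2)) * phi x.
Proof.
move=> /andP[s0 s1] /andP[h0 hx].
have -> : normal_pdf 0 s x = s^-1 * expR (- ((s ^- 2 - 1) * x ^+ 2 / 2)) * phi x.
  rewrite phiE /normal_pdf gt_eqF// /normal_fun /normal_peak subr0.
  rewrite expr1n mul1r -mulrnAr sqrtrM ?sqr_ge0// sqrtr_sqr gtr0_norm// invfM.
  rewrite mulrACA -expRD; congr (_ * expR _).
  by field; rewrite gt_eqF.
rewrite ler_wpM2r ?phi_ge0// ler_wpM2l ?invr_ge0 ?(ltW s0)// ler_expR lerN2 ler_wpM2r//.
have x0 := le_trans h0 hx.
rewrite ler_wpM2l// ?lerXn2r ?nnegrE//.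
by rewrite subr_ge0 invf_ge1 ?exprn_gt0// expr_le1// ltW.
Qed.

Lemma normal_tail_le s h : 0 < s < 1 -> 0 <= h ->
  (normal_prob 0 s `]h, +oo[ <=
   (s^-1 * expR (- ((s ^- 2 - 1) * h ^+ 2 / 2)))%:E * normal_prob 0 1 `]h, +oo[)%E.
Proof.
move=> s01 h0.
have mpdf r A : measurable A -> measurable_fun A (fun x : measurableTypeR R => (normal_pdf 0 r x)%:E).
  by move=> mA; apply: measurable_funTS; apply/measurable_EFinP; exact: measurable_normal_pdf.
have s0 : 0 < s by case/andP: s01.
have c0 : 0 <= s^-1 * expR (- ((s ^- 2 - 1) * h ^+ 2 / 2)).
  by rewrite mulr_ge0 ?expR_ge0// invr_ge0 ltW.
rewrite /normal_prob -ge0_integralZl//=; last 2 first.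
- exact: mpdf.
- by move=> x _; rewrite lee_fin normal_pdf_ge0.
apply: ge0_le_integral => //.
- by move=> x _; rewrite lee_fin normal_pdf_ge0.
- exact: mpdf.
- by apply: emeasurable_funM => //; exact: mpdf.
- move=> x; rewrite /= in_itv/= andbT => hx.
  by rewrite -EFinM lee_fin normal_pdf_tail_le// h0 ltW.
Qed.

Lemma normal_tail_near s e : 0 < s < 1 -> 0 < e ->
  \forall h \near +oo, (normal_prob 0 s `]h, +oo[ <= e%:E * normal_prob 0 1 `]h, +oo[)%E.
Proof.
move=> s01 e0; have /andP[s0 s1] := s01.
have d0 : 0 < s ^- 2 - 1 by rewrite subr_gt0 invf_gt1 ?exprn_gt0// expr_lt1// ltW.
near=> h.
have h1 : 1 <= h by near: h; apply: nbhs_pinfty_ge; exact: num_real.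
apply: (le_trans (normal_tail_le s01 _)); first by rewrite (le_trans ler01).
apply: lee_wpmul2r => //; rewrite lee_fin.
(* From this point on, [1 + (s ^- 2 - 1) * h ^+ 2 / 2] exceeds the inverse of [s * e], using
   [h <= h ^+ 2]; [expR_ge1Dx] then suffices. *)
have hd : 2 / (s * e * (s ^- 2 - 1)) <= h by near: h; apply: nbhs_pinfty_ge; exact: num_real.
rewrite expRN -invfM invf_ple ?posrE ?mulr_gt0 ?expR_gt0//.
rewrite -ler_pdivrMl// -invfM; apply: (le_trans _ (expR_ge1Dx _)).
move: hd; rewrite ler_pdivrMr ?mulr_gt0// => hd.
rewrite -[leLHS]mul1r ler_pdivrMr ?mulr_gt0//.
have hh : h <= h ^+ 2 by rewrite expr2 ler_peMr// (le_trans ler01).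
have : h * (s * e * (s ^- 2 - 1)) <= h ^+ 2 * (s * e * (s ^- 2 - 1)).
  by rewrite ler_wpM2r// !mulr_ge0// ltW.
have := mulr_ge0 (ltW s0) (ltW e0).
lra.
Unshelve. all: by end_near. Qed.
End tails.

(** * Vanishing combinations and joint exceedances of a standard Gaussian vector *)

Section threshold_tails.
Variables (R : realType) (d : measure_display) (T : measurableType d).
Variables (P : probability T R) (n : nat) (X : 'I_n -> {RV P >-> R}).
Hypothesis HX : standard_gaussian_vector X.

(** Were the covariance form positive at every nonzero vector, diagonalization would give full
    support. Elsewhere the form equals some [s ^+ 2] and is not positive, so [s = 0] and the
    combination is concentrated at 0. *)
Lemma not_fully_supported_lincomb : ~ fully_supported X ->
  exists2 a : 'rV[R]_n, a != 0 & P [set w | lincomb X (a 0) w != 0] = 0%E.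
Proof.
move=> nfull.
have [a a0 Qa] : exists2 a : 'rV[R]_n, a != 0 & ~~ (0 < (a *m covmx X *m a^T) 0 0).
  apply: contrapT => nex; apply: nfull.
  have [|B] := posdef_diagonalize (covmx_sym X); last exact: fully_supported_diagonalizable.
  by move=> a a0; apply: contrapT => /negP Qa; apply: nex; exists a.
exists a => //; have [s [s0 sE law _]] := lincomb_law HX a.
have {}s0 : s = 0.
  apply/eqP; apply: contraNT Qa => sN0.
  by rewrite -sE exprn_gt0// lt_neqAle eq_sym sN0.
have := law (~` [set 0]); rewrite s0 eqxx => Hl.
have -> : [set w | lincomb X (a 0) w != 0] = lincomb X (a 0) @^-1` (~` [set 0]).
  by apply/seteqP; split => w /=; [move/eqP|move/eqP].
rewrite Hl; last exact: measurableC.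
by rewrite diracE memNset//= => /(_ erefl).
Qed.

Lemma coord_law i (A : set R) : measurable A ->
  P (X i @^-1` A) = normal_prob 0 1 A.
Proof.
move=> mA; have [s [s0 sE law _]] := lincomb_law HX (delta_mx 0 i).
have s1 : s = 1.
  apply/eqP; rewrite -sqrp_eq1//; apply/eqP.
  by rewrite sE -rowE trmx_delta -colE !mxE -/(covmx X i i) -[RHS](covmx_diag HX i) !mxE.
have lE : lincomb X ((delta_mx 0 i : 'rV[R]_n) 0) = X i.
  apply/funext => w; rewrite /lincomb (bigD1 i)//= mxE !eqxx mul1r big1 ?addr0// => j /negbTE.
  by rewrite mxE eqxx => ->; rewrite mul0r.
by have := law A mA; rewrite s1 oner_eq0 lE.
Qed.

(** A joint exceedance forces the average of the two coordinates above [h], and this average has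
    variance [(1 + covmx X i j) / 2 < 1]. *)
Lemma pair_tail_near i j (e : R) : covmx X i j < 1 -> 0 < e ->
  \forall h \near +oo, (P [set w | (h < X i w)%R && (h < X j w)%R] <=
    e%:E * normal_prob 0 1 `]h, +oo[)%E.
Proof.
move=> cij e0.
pose a : 'rV[R]_n := 2^-1 *: (delta_mx 0 i + delta_mx 0 j).
have [s [s0 sE law _]] := lincomb_law HX a.
have aE w : lincomb X (a 0) w = (X i w + X j w) / 2.
  have D k : \sum_l (k == l)%:R * X l w = X k w.
    rewrite (bigD1 k)//= eqxx mul1r big1 ?addr0// => l.
    by rewrite eq_sym => /negbTE ->; rewrite mul0r.
  rewrite -(D i) -(D j) -big_split/= mulr_suml; apply: eq_bigr => l _.
  by rewrite !mxE eqxx/= ![l == _]eq_sym; field.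
have s1 : s < 1.
  have cji : covmx X j i = covmx X i j by rewrite -[in LHS](covmx_sym X) mxE.
  have aT : a^T = 2^-1 *: (delta_mx i 0 + delta_mx j 0).
    by apply/matrixP => k l; rewrite !mxE ord1 !eqxx !andbT.
  rewrite -(@expr_lt1 _ 2)// sE -scalemxAl mulmxDl -!rowE.
  rewrite aT -scalemxAr mulmxDr -!colE.
  set C := covmx X in cij cji *.
  have Cii k : C k k = 1 by exact: covmx_diag.
  have -> : (2^-1 *: (col i (2^-1 *: (row i C + row j C)) +
      col j (2^-1 *: (row i C + row j C)))) 0 0 = (C i i + C j i + C i j + C j j) / 4.
    by rewrite !mxE; field.
  by rewrite !Cii cji; lra.
have sub h : [set w | (h < X i w)%R && (h < X j w)%R] `<=` lincomb X (a 0) @^-1` `]h, +oo[.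
  by move=> w /= /andP[hi hj]; rewrite in_itv/= andbT aE; lra.
have mh h : measurable [set w | (h < X i w)%R && (h < X j w)%R].
  rewrite (_ : mkset _ = X i @^-1` `]h, +oo[ `&` X j @^-1` `]h, +oo[).
    by apply: measurableI; apply: measurable_funPTI; exact: measurable_itv.
  by apply/seteqP; split => w /=; rewrite !in_itv/= !andbT => /andP.
have le_h h : (P [set w | (h < X i w)%R && (h < X j w)%R] <=
    P (lincomb X (a 0%R) @^-1` `]h, +oo[))%E.
  apply: le_measure; [exact/mem_set/mh|apply/mem_set|exact: sub].
  by rewrite -[_ @^-1` _]setTI; apply: (measurable_lincomb X (a 0)).
(* Correlation -1 gives [s = 0]: the average is then almost surely 0 and does not exceed
   [h >= 0]. *)
have [sz|sN0] := eqVneq s 0.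
  near=> h; apply: (le_trans (le_h h)); rewrite law; last exact: measurable_itv.
  have N0 : ~ `]h, +oo[%classic (0 : R).
    rewrite /= in_itv/= andbT; apply/negP; rewrite -leNgt.
    by near: h; apply: nbhs_pinfty_ge; exact: num_real.
  by rewrite sz eqxx diracE memNset// mule_ge0// lee_fin ltW.
have s01 : 0 < s < 1 by rewrite s1 andbT lt_neqAle eq_sym sN0.
have := normal_tail_near s01 e0; apply: filterS => h.
apply: le_trans; apply: (le_trans (le_h h)).
by rewrite law ?(negbTE sN0)//; exact: measurable_itv.
Unshelve. all: by end_near. Qed.
End threshold_tails.

(** * Color processes *)

Section color_law.
Variables (R : realType) (S : finType) (p : R) (q : {set {set S}} -> R).
Hypothesis p01 : 0 < p < 1.
Hypothesis q_law : partition_law q.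

Let coin (c : {ffun {set S} -> bool}) := \prod_B bernoulli_pmf p (c B).
Let color (rho : {set {set S}}) (c : {ffun {set S} -> bool}) : {ffun S -> bool} :=
  [ffun i => c (finset.pblock rho i)].

Let coin_gt0 c : 0 < coin c.
Proof.
have /andP[p0 p1] := p01.
by apply: prodr_gt0 => B _; rewrite /bernoulli_pmf; case: (c B) => //; rewrite subr_gt0.
Qed.

Lemma sum_coin_true (B0 : {set S}) : \sum_(c : {ffun {set S} -> bool} | c B0) coin c = p.
Proof.
(* Putting weight 0 on the value [false] at [B0] moves the constraint into the product, so that the
   sum of products factors into one sum per coin. *)
pose F B (b : bool) := if B == B0 then b%:R * p else bernoulli_pmf p b.
transitivity (\sum_(c : {ffun {set S} -> bool}) \prod_B F B (c B)).
  rewrite big_mkcond; apply: eq_bigr => c _.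
  rewrite (bigD1 B0)//= {1}/F eqxx; case: ifP => cB0; last by rewrite !mul0r.
  rewrite mul1r /coin (bigD1 B0)//= cB0; congr (_ * _).
  by apply: eq_bigr => B /negbTE BB0; rewrite /F BB0.
rewrite -bigA_distr_bigA (bigD1 B0)//= [X in _ * X]big1.
  by rewrite mulr1 big_bool/= /F eqxx mul1r mul0r addr0.
by move=> B /negbTE BB0; rewrite big_bool /F BB0 /bernoulli_pmf/= subrKC.
Qed.

(** Every pair of a partition and a coin assignment produces exactly one coloring, so summing over
    the colorings in [A] amounts to summing over the pairs that land in [A]. *)
Lemma sum_color_law (A : pred {ffun S -> bool}) :
  \sum_(y | A y) color_process_law p q y =
  \sum_rho q rho * \sum_(c | A (color rho c)) coin c.
Proof.
rewrite /color_process_law exchange_big/=; apply: eq_bigr => rho _.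
rewrite (exchange_big_dep (fun c => A (color rho c)))/=; last first.
  by move=> y c Ay /eqP yc; rewrite /color -yc.
rewrite mulr_sumr; apply: eq_bigr => c Ac.
rewrite (big_pred1 (color rho c)) // => y /=.
by rewrite -/(color rho c); case: eqP => [->|]; rewrite ?andbT ?andbF.
Qed.

Lemma color_law_marginal i : \sum_(y | (y : {ffun S -> bool}) i) color_process_law p q y = p.
Proof.
have [_ _ q1] := q_law.
rewrite sum_color_law -[RHS]mul1r -q1 mulr_suml; apply: eq_bigr => rho _; congr (_ * _).
(* By default [finset.pblock] returns the empty set, which carries a coin too, so the coin sum is
   [p] for every [rho]. *)
rewrite -(sum_coin_true (finset.pblock rho i)); apply: eq_bigl => c.
by rewrite ffunE.
Qed.

(** A partition of positive weight that separated [Pos] from [Neg] would give the pattern positive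
    probability. Hence each such partition joins some pair, and a union bound over pairs
    concludes. *)
Lemma color_law_pattern (Pos Neg : pred S) :
  \sum_(y | [forall i, (Pos i ==> (y : {ffun S -> bool}) i) && (Neg i ==> ~~ y i)]) color_process_law p q y = 0 ->
  p <= \sum_(i | Pos i) \sum_(j | Neg j)
    \sum_(y | (y : {ffun S -> bool}) i && y j) color_process_law p q y.
Proof.
have [q0 _ q1] := q_law; have /andP[p0 p1] := p01.
rewrite sum_color_law => sum0.
have same rho : q rho != 0 -> exists i j, [/\ Pos i, Neg j & finset.pblock rho i = finset.pblock rho j].
  move=> qrho; apply: contrapT => nex.
  (* Coins are [true] exactly on the blocks that meet [Pos]; without a common block this assignment
     realises the forbidden pattern. *)
  pose c : {ffun {set S} -> bool} := [ffun B => [exists i, Pos i && (finset.pblock rho i == B)]].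
  have /eqP := sum0; rewrite psumr_eq0; last first.
    by move=> r _; rewrite mulr_ge0// sumr_ge0// => c' _; rewrite ltW.
  move=> /allP/(_ rho); rewrite mem_index_enum => /(_ erefl)/=.
  rewrite mulf_eq0 (negbTE qrho)/= psumr_eq0; last by move=> c' _; rewrite ltW.
  move=> /allP/(_ c); rewrite mem_index_enum => /(_ erefl)/implyP.
  rewrite (gt_eqF (coin_gt0 c)) => H; apply: (Bool.diff_false_true (H _)).
  apply/forallP => i; rewrite !ffunE; apply/andP; split; apply/implyP => Hi.
    by apply/existsP; exists i; rewrite Hi eqxx.
  apply/existsP => -[k /andP[Pk /eqP ki]]; apply: nex; exists k, i.
  by split.
(* This is [p] times the probability that [i] and [j] share a block; a single coin then decides both
   sites. *)
pose sm i j := \sum_(rho | finset.pblock rho i == finset.pblock rho j) q rho * p.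
have pair_ge i j : sm i j <= \sum_(y | (y : {ffun S -> bool}) i && y j) color_process_law p q y.
  rewrite sum_color_law /sm big_mkcond; apply: ler_sum => rho _.
  case: eqP => [ij|_]; last by rewrite mulr_ge0// sumr_ge0// => c' _; rewrite ltW.
  rewrite -(sum_coin_true (finset.pblock rho i)) le_eqVlt; apply/orP; left; apply/eqP.
  by congr (_ * _); apply: eq_bigl => c; rewrite !ffunE ij andbb.
apply: (@le_trans _ _ (\sum_(i | Pos i) \sum_(j | Neg j) sm i j)); last first.
  by apply: ler_sum => i _; apply: ler_sum => j _; exact: pair_ge.
rewrite -[leLHS]mul1r -q1 mulr_suml.
(* Partition by partition, the double sum counts the joined pairs, and [same] supplies at least one
   whenever [q rho] is nonzero. *)
have -> : \sum_(i | Pos i) \sum_(j | Neg j) sm i j =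
    \sum_rho \sum_(i | Pos i) \sum_(j | Neg j) (finset.pblock rho i == finset.pblock rho j)%:R * (q rho * p).
  rewrite [RHS]exchange_big/=; apply: eq_bigr => i _.
  rewrite [RHS]exchange_big/=; apply: eq_bigr => j _.
  rewrite /sm big_mkcond; apply: eq_bigr => rho _.
  by case: eqP; rewrite ?mul1r ?mul0r.
apply: ler_sum => rho _.
have t0 i j : 0 <= (finset.pblock rho i == finset.pblock rho j)%:R * (q rho * p).
  by rewrite !mulr_ge0// ltW.
have [->|/same[i [j [Pi Nj ij]]]] := eqVneq (q rho) 0.
  by rewrite mul0r; apply: sumr_ge0 => i _; apply: sumr_ge0 => j _; rewrite mulr0.
rewrite (bigD1 i)//= (bigD1 j)//= ij eqxx mul1r -addrA lerDl addr_ge0//.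
  exact: sumr_ge0.
by apply: sumr_ge0 => k _; apply: sumr_ge0.
Qed.
End color_law.

(** * Events determined by finitely many binary variables *)

Section configurations.
Variables (R : realType) (d : measure_display) (T : measurableType d).
Variables (P : probability T R) (S : finType) (Y : S -> T -> bool).
Hypothesis mY : forall i b, measurable [set w | Y i w = b].

Let measurable_configuration (y : S -> bool) : measurable [set w | forall i, Y i w = y i].
Proof.
rewrite (_ : mkset _ = \bigcap_(i in [set: S]) [set w | Y i w = y i]).
  exact: fin_bigcap_measurable.
by apply/seteqP; split => [w Yw i _|w Yw i]; exact: Yw.
Qed.

Let configurationsE (A : pred {ffun S -> bool}) : [set w | A [ffun i => Y i w]] =
  \bigcup_(y in [set` enum A]) [set w | forall i, Y i w = y i].
Proof.
apply/seteqP; split => [w Aw|w [y /=]].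
  by exists [ffun i => Y i w] => [|i]; rewrite ?ffunE//= mem_enum.
rewrite mem_enum => Ay Yw; suff -> : [ffun i => Y i w] = y by [].
by apply/ffunP => i; rewrite ffunE.
Qed.

Lemma measurable_configurations (A : pred {ffun S -> bool}) :
  measurable [set w | A [ffun i => Y i w]].
Proof. by rewrite configurationsE; apply: fin_bigcup_measurable. Qed.

Lemma probability_configurations (A : pred {ffun S -> bool}) :
  P [set w | A [ffun i => Y i w]] =
  (\sum_(y | A y) P [set w | forall i, Y i w = y i])%E.
Proof.
rewrite configurationsE measure_fin_bigcup//.
  by rewrite -fsbig_seq ?enum_uniq// big_enum.
move=> y y' _ _ [w [/= yw y'w]]; apply/ffunP => i.
by rewrite -yw y'w.
Qed.
End configurations.

(** * Comparison of Gaussian tails with the color process inequality *)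

Unset Implicit Arguments.

Theorem corollary5p3 (R : realType) (d : measure_display)
    (T : measurableType d) (P : probability T R) (n : nat)
    (X : 'I_n -> {RV P >-> R})
    (HX : standard_gaussian_vector X)
    (Hcov : forall i j : 'I_n, (i < j)%N ->
      (0 <= covariance P (X i) (X j))%E /\ (covariance P (X i) (X j) < 1)%E)
    (Hsupp : ~ fully_supported X) :
  \forall h \near +oo, ~ color_process P (threshold X h).
Proof.
have [a0 a0N0 Pa0] := not_fully_supported_lincomb HX Hsupp.
(* Negating all coefficients if necessary makes their sum nonnegative and leaves the null event
   unchanged. *)
have [a aN0 [Pa a_ge0]] : exists2 a : 'I_n -> R, (exists i, a i != 0) &
    P [set w | lincomb X a w != 0] = 0%E /\ 0 <= \sum_i a i.
  have [i ai] : exists i, a0 0 i != 0.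
    by apply/rV0Pn.
  have [s0|s0] := leP 0 (\sum_i a0 0 i); first by exists (a0 0) => //; exists i.
  exists (fun i => - a0 0 i); first by exists i; rewrite oppr_eq0.
  rewrite sumrN oppr_ge0 ltW//; split => //; rewrite -[RHS]Pa0; congr (P _).
  have lN w : lincomb X (fun i => - a0 0 i) w = - lincomb X (a0 0) w.
    by rewrite /lincomb -sumrN; apply: eq_bigr => i' _; rewrite mulNr.
  by apply/seteqP; split => w /=; rewrite lN oppr_eq0.
have [i0 ai0] := aN0.
(* At most [n * n] pairs enter the union bound, so a bound [e * p] for each pair keeps the total
   strictly below [p]. *)
pose e : R := (n * n).+1%:R^-1.
have e0 : 0 < e by rewrite invr_gt0.
have cov1 i j : i != j -> covmx X i j < 1.
  wlog ij : i j / (i < j)%N.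
    move=> H; rewrite neq_ltn => /orP[ij|ji]; first by apply: H => //; rewrite neq_ltn ij.
    rewrite -(covmx_sym X) mxE; apply: H => //; by rewrite neq_ltn ji.
  move=> _; have [c0 c1] := Hcov i j ij; rewrite mxE.
  by rewrite -lte_fin fineK// ge0_fin_numE// (lt_trans c1)// ltry.
have tails : \forall h \near +oo, forall i j, i != j ->
    (P [set w | (h < X i w)%R && (h < X j w)%R] <= e%:E * normal_prob 0 1 `]h, +oo[)%E.
  apply: filter_forall => i; apply: filter_forall => j.
  have [->|ij] := eqVneq i j; first by apply: nearW => h.
  by apply: filterS (pair_tail_near HX (cov1 _ _ ij) e0) => h + _.
(* This will give [p < 1], since [p] turns out to be the probability that [X i0] exceeds [h]. *)
have lt1 : \forall h \near +oo, (ccdf (X i0) h < 1)%E.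
  have /fine_cvg/cvgr_lt/(_ _ ltr01) := cvg_ccdfy0 (X i0).
  apply: filterS => h; by rewrite -lte_fin fineK// fin_num_measure.
near=> h; move=> [p [q [p01 q_law Yq]]].
have h0 : 0 <= h by near: h; apply: nbhs_pinfty_ge; exact: num_real.
have mY (i : 'I_n) (b : bool) : measurable [set w | threshold X h i w = b].
  have m1 : measurable [set w | threshold X h i w].
    rewrite (_ : mkset _ = X i @^-1` `]h, +oo[).
      by apply: measurable_funPTI; exact: measurable_itv.
    by apply/seteqP; split => w; rewrite /= in_itv/= andbT.
  case: b => //; rewrite (_ : mkset _ = ~` [set w | threshold X h i w]).
    exact: measurableC.
  by apply/seteqP; split => w /=; [move=> ->|move/negP/negbTE].
have PX i : P [set w | h < X i w] = normal_prob 0 1 `]h, +oo[.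
  rewrite -(coord_law HX i)//; congr (P _).
  by apply/seteqP; split => w /=; rewrite in_itv/= andbT.
have PA (A : pred {ffun 'I_n -> bool}) :
    P [set w | A [ffun i => threshold X h i w]] = (\sum_(y | A y) color_process_law p q y)%:E.
  rewrite (probability_configurations P mY).
  by rewrite -sumEFin; apply: eq_bigr => y _.
have PXi i : P [set w | h < X i w] =
    (\sum_(y | (y : {ffun 'I_n -> bool}) i) color_process_law p q y)%:E.
  by rewrite -(PA (fun y => y i)); congr (P _); apply/seteqP; split => w /=; rewrite ffunE.
have PXij i j : P [set w | (h < X i w) && (h < X j w)] =
    (\sum_(y | (y : {ffun 'I_n -> bool}) i && y j) color_process_law p q y)%:E.
  by rewrite -(PA (fun y => y i && y j)); congr (P _); apply/seteqP; split => w /=; rewrite !ffunE.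
have pE : p%:E = normal_prob 0 1 `]h, +oo[.
  by rewrite -(PX i0) PXi (color_law_marginal p q_law).
have {}p01 : 0 < p < 1.
  rewrite -!lte_fin pE normal_tail_gt0//= -(coord_law HX i0)//.
  by near: h.
have /andP[p0 _] := p01.
pose Pos i := 0 < a i; pose Neg i := a i < 0.
pose A (y : {ffun 'I_n -> bool}) := [forall i, (Pos i ==> y i) && (Neg i ==> ~~ y i)].
(* On the pattern every [a i * X i w] is at least [a i * h], strictly so where [a i > 0]; the
   combination then exceeds [h] times the sum of the coefficients, which is nonnegative, and the
   pattern lies in the null event. *)
have pattern0 : \sum_(y | A y) color_process_law p q y = 0.
  apply: EFin_inj; rewrite -PA; apply: (subset_measure0 _ _ _ Pa).
  - exact: (measurable_configurations mY A).
  - rewrite (_ : mkset _ = [set: T] `&` lincomb X a @^-1` (~` [set 0])).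
      by apply: measurable_lincomb => //; exact: measurableC.
    by rewrite setTI; apply/seteqP; split => w /= /eqP.
  move=> w /= /forallP pat; rewrite gt_eqF//.
  have aX i : a i * h <= a i * X i w.
    have := pat i; rewrite !ffunE /threshold /Pos /Neg -leNgt.
    have [ai|ai|->] := ltgtP (a i) 0; last by rewrite !mul0r.
      by move=> /= hX; rewrite ler_nM2l.
    by move=> /andP[/= hX _]; rewrite ler_pM2l// ltW.
  (* Without a positive coefficient, the nonnegative sum would force every coefficient to vanish,
     against the choice of [i0]. *)
  have [i1 ai1] : exists i, 0 < a i.
    apply: contrapT => nex; have a_le0 i : a i <= 0.
      by rewrite leNgt; apply/negP => ai; apply: nex; exists i.
    have : \sum_i - a i = 0.
      by apply/eqP; rewrite eq_le sumrN oppr_le0 a_ge0 oppr_ge0 sumr_le0.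
    move=> /eqP; rewrite psumr_eq0 => [|i _]; last by rewrite oppr_ge0.
    by move=> /allP/(_ i0); rewrite mem_index_enum oppr_eq0 (negbTE ai0) => /(_ erefl).
  apply: (@le_lt_trans _ _ (\sum_i a i * h)).
    by rewrite -mulr_suml mulr_ge0.
  rewrite /lincomb [ltLHS](bigD1 i1)//= [ltRHS](bigD1 i1)//=.
  rewrite ltr_leD ?ler_sum// ltr_pM2l//.
  by have := pat i1; rewrite !ffunE /Pos ai1 => /andP[].
have := color_law_pattern p01 q_law pattern0; apply/negP; rewrite -ltNge.
apply: (@le_lt_trans _ _ (\sum_(i < n) \sum_(j < n) e * p)); last first.
  rewrite !sumr_const !card_ord -mulrnA -mulr_natl mulrA gtr_pMl//.
  by rewrite /e ltr_pdivrMr// mul1r ltr_nat.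
have ep0 : 0 <= e * p by rewrite mulr_ge0// ltW.
apply: (@le_trans _ _ (\sum_(i < n | Pos i) \sum_(j < n) e * p)); last first.
  rewrite [leRHS](bigID Pos)/= lerDl; apply: sumr_ge0 => i _; exact: sumr_ge0.
apply: ler_sum => i Pi.
apply: (@le_trans _ _ (\sum_(j < n | Neg j) e * p)); last first.
  by rewrite [leRHS](bigID Neg)/= lerDl; exact: sumr_ge0.
apply: ler_sum => j Nj.
rewrite -lee_fin -PXij EFinM pE.
have ij : i != j by apply/eqP => ij; move: Pi Nj; rewrite /Pos /Neg ij; lra.
by move: i j ij {Pi Nj}; near: h.
Unshelve. all: by end_near. Qed.
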